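(* Fix $\theta\in\mathbb{R}$ and let $\mathbf{T}=(T_1,\dots,T_N)$ be $N$ i.i.d. observations from the density $f(\cdot|G,\theta)$ (model in the context), with positive parts $Y_1<\dots<Y_n$ and negative parts $Z_{N-n}<\dots<Z_1$ of $T_1-\theta,\dots,T_N-\theta$. Then the distribution of the latent vector $\mathbf{X}=(X_1,\dots,X_N)$ given $\theta$ and $\mathbf{T}$ is summarized by the joint law, given $(\theta,\mathbf{T})$, of $(\mathbf{V},\mathbf{U})$ and $(\mathbf{S}^-,\mathbf{S}^+)$ (the paths and unique values determined by $\mathbf{X}$, see context) described as follows. (i) Given $(\theta,\mathbf{T})$, the two $\mathbf{S}$-paths $\mathbf{S}^+=(0,S_1^+,\dots,S_{n-1}^+,n)$ and $\mathbf{S}^-=(0,S_1^-,\dots,S_{N-n-1}^-,N-n)$, of $n+1$ and $N-n+1$ coordinates, have the discrete joint distribution $$\pi(\mathbf{S}^-,\mathbf{S}^+|\theta,\mathbf{T})\propto \phi^+_\theta(\mathbf{S}^+,\mathbf{T})\times\phi^-_\theta(\mathbf{S}^-,\mathbf{S}^+,\mathbf{T}),$$ where $$\phi^+_\theta(\mathbf{S}^+,\mathbf{T})=|\mathbb{C}_{\mathbf{S}^+}|\,\chi(\mathcal{M}_{1,n}(\mathbf{S}^+))\prod_{1\le j\le n:\,S_j^+>S_{j-1}^+}\int_{Y_j}^{\infty}U_j^{-(S_j^+-S_{j-1}^+)}H(dU_j)$$ and $$\phi^-_\theta(\mathbf{S}^-,\mathbf{S}^+,\mathbf{T})=|\mathbb{C}_{\mathbf{S}^-}|\,\frac{\chi(\mathcal{M}_{1,n}(\mathbf{S}^+),\mathcal{M}_{1,N-n}(\mathbf{S}^-))}{\chi(\mathcal{M}_{1,n}(\mathbf{S}^+))}\prod_{1\le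 j\le N-n:\,S_j^->S_{j-1}^-}\int_{-\infty}^{Z_j}(-V_j)^{-(S_j^--S_{j-1}^-)}H(dV_j).$$ (ii) Given $(\mathbf{S}^-,\mathbf{S}^+)$ and $(\theta,\mathbf{T})$, there are $N(\mathbf{S}^+)=\sum_{j=1}^n\mathbb{I}(S_j^+>S_{j-1}^+)$ positive and $N(\mathbf{S}^-)=\sum_{j=1}^{N-n}\mathbb{I}(S_j^->S_{j-1}^-)$ negative unique values among $X_1,\dots,X_N$, denoted $\mathbf{U}=\{U_j:S_j^+>S_{j-1}^+,\ j=1,\dots,n\}$ and $\mathbf{V}=\{V_j:S_j^->S_{j-1}^-,\ j=1,\dots,N-n\}$, respectively. They are conditionally independent of one another, with distributions $$H_j^+(dU_j|\mathbf{S}^+,\mathbf{Y})\propto\mathbb{I}(Y_j\le U_j)\,U_j^{-(S_j^+-S_{j-1}^+)}H(dU_j)$$ and $$H_j^-(dV_j|\mathbf{S}^-,\mathbf{Z})\propto\mathbb{I}(V_j\le Z_j)\,(-V_j)^{-(S_j^--S_{j-1}^-)}H(dV_j),$$ respectively.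
   Context: Species sampling model. $G$ is a random probability measure on $\mathbb{R}$ of the form $G(\cdot)=\sum_k W_k\delta_{\xi_k}(\cdot)+(1-\sum_kW_k)H(\cdot)$, where $H$ is a non-atomic probability measure on $\mathbb{R}$, the $\xi_k$ are i.i.d. $H$, and the random weights $0<W_k<1$, $\sum_kW_k\le1$, are independent of the $\xi_k$. If $X_1,\dots,X_N$ are i.i.d. from $G$ given $G$, with partition $\mathbf{p}=\{C_1,\dots,C_{N(\mathbf{p})}\}$ of $\{1,\dots,N\}$ into the classes of equal values, $C_k=\{j:X_j=X_k^*\}$, $X_k^*$ the unique values, $e_k=|C_k|$, then the joint law of $(X_1,\dots,X_N)$ is $\pi(\mathbf{p})\prod_{k=1}^{N(\mathbf{p})}H(dX_k^* )$ with $\pi(\mathbf{p})=\chi(e_1,\dots,e_{N(\mathbf{p})})$. Here $\chi$ is a symmetric function of finite lists of positive integers (the exchangeable partition probability function of $G$, defined for every sample size); $\chi$ of the empty list is $1$. Model. Given $G$ and $\theta$, the pairs $(X_k,T_k)$, $k=1,\dots,N$, are i.i.d.: $X_k\sim G$ is latent and $T_k$ given $X_k=x$ has density $x^{-1}[\mathbb{I}(0<t-\theta\le x)-\mathbb{I}(x\le t-\theta<0)]$ in $t$. So the $T_k$ are i.i.d. given $(G,\theta)$ with density $f(t|G,\theta)=\int X^{-1}[\mathbb{I}(0<t-\theta\le X)-\mathbb{I}(X\le t-\theta<0)]\,G(dX)$. $\mathbb{I}$ is the indicator. Ordering. The values $T_1-\theta,\dots,T_N-\theta$ are (almost surely) distinct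 and nonzero and are listed as $\mathbf{Z}=(Z_{N-n},\dots,Z_1)$, $Z_{N-n}<\dots<Z_1<0$, and $\mathbf{Y}=(Y_1,\dots,Y_n)$, $0<Y_1<\dots<Y_n$; so $n$ depends on $\theta$ and $\mathbf{T}$. Given $\theta,\mathbf{T}$, an observation with $T_k-\theta>0$ has $X_k>0$ and one with $T_k-\theta<0$ has $X_k<0$, so the partition induced by $\mathbf{X}$ splits as $\mathbf{p}=\mathbf{p}^+\cup\mathbf{p}^-$, with $\mathbf{p}^+$ regarded as a partition of the labels $\{1,\dots,n\}$ of the $Y$'s and $\mathbf{p}^-$ as a partition of the labels $\{1,\dots,N-n\}$ of the $Z$'s. $\mathbf{S}$-paths. An $\mathbf{S}$-path of $n+1$ coordinates is an integer vector $\mathbf{S}=(S_0,\dots,S_n)$ with $S_0=0$, $S_n=n$, $S_j\le j$ and $S_j\le S_{j+1}$ for $j=1,\dots,n-1$. A partition of $\{1,\dots,n\}$ corresponds to $\mathbf{S}$ if the maximal elements of its cells are exactly the $j$ with $S_j>S_{j-1}$ and the cell with maximal element $j$ has size $S_j-S_{j-1}$. $\mathbb{C}_{\mathbf{S}}$ is the set of partitions corresponding to $\mathbf{S}$; $|\mathbb{C}_{\mathbf{S}}|=\prod_{j:S_j>S_{j-1}}\binom{j-1-S_{j-1}}{j-S_j}$. $\mathcal{M}_{a,b}(\mathbf{S})$ is the list (multiset) $\{S_j-S_{j-1}:S_j>S_{j-1},\ a\le j\le b\}$; $\chi(\mathcal{M},\mathcal{M}')$ is $\chi$ evaluated at the concatenated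 list. Paths and unique values determined by $\mathbf{X}$: $\mathbf{S}^+$ (resp. $\mathbf{S}^-$) is the path to which $\mathbf{p}^+$ (resp. $\mathbf{p}^-$) corresponds; $U_j$ (resp. $V_j$) is the common $X$-value of the cell of $\mathbf{p}^+$ (resp. $\mathbf{p}^-$) with maximal element $j$. Conditional laws given $(\theta,\mathbf{T})$ are the versions given by Bayes' formula, for $\mathbf{T}$ of positive marginal density; a pair of paths for which some factor in $\phi^+_\theta\phi^-_\theta$ (including a denominator) vanishes has probability zero. *)

(* Defs.v *)
From HB Require Import structures.
From mathcomp Require Import all_boot all_order all_algebra.
From mathcomp Require Import all_classical all_reals all_analysis.

Set Implicit Arguments.
Unset Strict Implicit.
Unset Printing Implicit Defensive.

Import Order.TTheory GRing.Theory Num.Theory.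
Import numFieldNormedType.Exports.

Local Open Scope classical_set_scope.
Local Open Scope ring_scope.

Section SpeciesSampling.
Context (R : realType) (d : measure_display) (Omega : measurableType d)
  (P : probability Omega R).

Implicit Types (H : probability (measurableTypeR R) R)
  (G : Omega -> probability (measurableTypeR R) R)
  (W xi : nat -> {RV P >-> measurableTypeR R}) (K : pred nat).

(** The atoms are indexed by the [k] with [K k]: [K] may be finite, infinite or
    empty. Both independence conditions are product rules on finite-dimensional
    rectangles; a constraint on a single index is obtained by taking the other
    sets equal to [setT]. *)
Record species_sampling H K W xi G : Prop := {
  ssm_nonatomic : forall x, H [set x] = 0%E ;
  ssm_weight_itv : forall k w, K k -> 0 < W k w < 1 ;
  ssm_weight_sum : forall w, (\sum_(k <oo | K k) (W k w)%:E <= 1)%E ;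
  ssm_xi_iid : forall (m : nat) (A : nat -> set (measurableTypeR R)),
    (forall k, measurable (A k)) ->
    fine (P [set w | forall k, (k < m)%N -> K k -> A k (xi k w)])
    = \prod_(k < m | K k) fine (H (A k)) ;
  ssm_indep : forall (m : nat) (A B : nat -> set (measurableTypeR R)),
    (forall k, measurable (A k)) -> (forall k, measurable (B k)) ->
    P [set w | forall k, (k < m)%N -> K k -> A k (xi k w) /\ B k (W k w)]
    = (P [set w | forall k, (k < m)%N -> K k -> A k (xi k w)] *
       P [set w | forall k, (k < m)%N -> K k -> B k (W k w)])%E ;
  ssm_form : forall w (A : set (measurableTypeR R)), measurable A ->
    G w A = (\sum_(k <oo | K k) (W k w)%:E * \d_(xi k w : measurableTypeR R) A
             + (1 - \sum_(k <oo | K k) (W k w)%:E) * H A)%E }.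

Definition cell_sizes m (p : {set {set 'I_m}}) : seq nat :=
  [seq #|C : {set 'I_m}| | C <- enum p].

(** [eppf_law] says that the law of [m] draws, i.i.d. from [G] given [G], is
    [\sum_p chi(sizes of p) \prod_k H(dX*_k)], evaluated on the rectangle
    [A_1 x ... x A_m]: all coordinates in a cell [C] share one value, which has
    to lie in the intersection of the [A i], [i \in C]. *)
Record is_eppf H G (chi : seq nat -> R) : Prop := {
  eppf_ge0 : forall s, all (leq 1) s -> 0 <= chi s ;
  eppf_sym : forall s1 s2, all (leq 1) s1 -> perm_eq s1 s2 -> chi s1 = chi s2 ;
  eppf_nil : chi [::] = 1 ;
  eppf_law : forall (m : nat) (A : 'I_m -> set (measurableTypeR R)),
    (forall i, measurable (A i)) ->
    (\int[P]_w (\prod_(i < m) fine (G w (A i))))%R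
    = \sum_(p : {set {set 'I_m}} | finset.partition p [set: 'I_m]%SET)
        chi (cell_sizes p) *
        \prod_(C : {set 'I_m} | C \in p) fine (H (\bigcap_(i in [set i | i \in C]) A i)) }.

Definition sigma_of G : set (set Omega) :=
  <<s [set E | exists A B : set (measurableTypeR R),
         [/\ measurable A, measurable B & E = (fun w => fine (G w A)) @^-1` B]] >>.

(** Density in [t] of an observation whose latent value is [x]. *)
Definition kern (theta x t : R) : R :=
  x^-1 * ((0 < t - theta <= x)%R%:R - (x <= t - theta < 0)%R%:R).

(** Given [G], the pairs [(X k, T k)] are i.i.d. with law
    [kern theta x t dt G(dx)]. *)
Definition latent_model (theta : R) G (N : nat)
    (X T : 'I_N -> {RV P >-> measurableTypeR R}) : Prop :=
  forall (E : set Omega) (A B : 'I_N -> set (measurableTypeR R)),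
    sigma_of G E ->
    (forall k, measurable (A k)) -> (forall k, measurable (B k)) ->
    fine (P (E `&` [set w | forall k, A k (X k w) /\ B k (T k w)]))
    = (\int[P]_(w in E) \prod_(k < N)
         fine (\int[G w]_(x in A k)
                 \int[@lebesgue_measure R]_(t in B k) (kern theta x t)%:E))%R.

Section Bayes.
Context (theta : R) (N : nat) (X : 'I_N -> {RV P >-> measurableTypeR R}).

Definition likelihood (x t : 'I_N -> R) : R :=
  \prod_(k < N) kern theta (x k) (t k).

(** [\int_D likelihood x t  (law of X)(dx)]. *)
Definition bayes_num (t : 'I_N -> R) (D : set ('I_N -> R)) : \bar R :=
  (\int[P]_(w in [set w | D (fun k => X k w)])
     (likelihood (fun k => X k w) t)%:E)%E.

Definition marginal_density (t : 'I_N -> R) : \bar R := bayes_num t setT.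

(** Conditional probability that [X] lies in [D] given [T = t] (Bayes). *)
Definition posterior (t : 'I_N -> R) (D : set ('I_N -> R)) : R :=
  fine (bayes_num t D) / fine (marginal_density t).

End Bayes.

End SpeciesSampling.

(** [posY] and [posZ] list the observations by label: the element [j : 'I_n]
    stands for the label [j + 1], so that [Y_{j+1} = t (posY j) - theta] and
    [Z_{j+1} = t (posZ j) - theta]. Strict monotonicity and the signs make
    [posY] and [posZ] injective with disjoint images, so that [n <= N] and
    together they enumerate ['I_N]. *)
Record ordering (R : realType) (theta : R) (N n : nat) (t : 'I_N -> R)
    (posY : 'I_n -> 'I_N) (posZ : 'I_(N - n) -> 'I_N) : Prop := {
  ordering_Y_gt0 : forall j, 0 < t (posY j) - theta ;
  ordering_Z_lt0 : forall j, t (posZ j) - theta < 0 ;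
  ordering_Y_incr : forall i j : 'I_n, (i < j)%N ->
    t (posY i) - theta < t (posY j) - theta ;
  ordering_Z_decr : forall i j : 'I_(N - n), (i < j)%N ->
    t (posZ j) - theta < t (posZ i) - theta }.

(** The coordinates are natural numbers, so that also [S_0 <= S_1]; every
    coordinate is at most [n], which makes the type of paths finite. *)
Section SPaths.
Context (n : nat).

Definition is_spath (S : {ffun 'I_n.+1 -> 'I_n.+1}) : bool :=
  [&& S ord0 == 0 :> nat, S ord_max == n :> nat,
      [forall j, (S j <= j)%N]
    & [forall j : 'I_n, (S (widen_ord (leqnSn n) j) <= S (lift ord0 j))%N]].

Record spath : Type := SPath {
  spath_val :> {ffun 'I_n.+1 -> 'I_n.+1} ;
  _ : is_spath spath_val }.

HB.instance Definition _ := [isSub for spath_val].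
HB.instance Definition _ := [Finite of spath by <:].

Implicit Types (S : spath) (p : {set {set 'I_n}}).

(** [S_{j+1} - S_j]; the label with 0-based index [j] is [j + 1]. *)
Definition jump S (j : 'I_n) : nat :=
  (S (lift ord0 j) - S (widen_ord (leqnSn n) j))%N.

Definition is_max_of (j : 'I_n) (C : {set 'I_n}) : bool :=
  (j \in C) && [forall i in C, (i <= j)%N].

Definition corresponds p S : bool :=
  [&& finset.partition p [set: 'I_n]%SET,
      [forall j, [exists C in p, is_max_of j C] == (0 < jump S j)%N]
    & [forall C in p, forall j, is_max_of j C ==> (#|C| == jump S j)]].

Definition partitions_of S : {set {set {set 'I_n}}} :=
  [set p | corresponds p S]%SET.

(** The multiset [M_{1,n}(S)]. *)
Definition jumps S : seq nat :=
  [seq jump S j | j <- enum 'I_n & (0 < jump S j)%N].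

Definition n_cells S : nat := \sum_(j < n) (0 < jump S j)%N.

(** The partition of the labels [{1..n}] induced by [x], where [pos] maps labels
    to observations. *)
Definition label_partition (R : realType) (N : nat) (pos : 'I_n -> 'I_N)
    (x : 'I_N -> R) : {set {set 'I_n}} :=
  preim_partition (fun j => x (pos j)) [set: 'I_n]%SET.

End SPaths.

Section Posterior.
Context (R : realType) (H : probability (measurableTypeR R) R)
  (chi : seq nat -> R) (theta : R).

(** [\int_{A \cap [y, oo)} u^{-e} H(du)] and
    [\int_{A \cap (-oo, z]} (-v)^{-e} H(dv)]. *)
Definition int_pos (y : R) (e : nat) (A : set R) : R :=
  (\int[H]_(u in (A `&` `[y, +oo[)%classic) u ^- e)%R.

Definition int_neg (z : R) (e : nat) (A : set R) : R :=
  (\int[H]_(v in (A `&` `]-oo, z])%classic) (- v) ^- e)%R.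

Context (N n : nat) (t : 'I_N -> R)
  (posY : 'I_n -> 'I_N) (posZ : 'I_(N - n) -> 'I_N).

Let Y j := t (posY j) - theta.
Let Z j := t (posZ j) - theta.

Definition phi_pos (Sp : spath n) : R :=
  #|partitions_of Sp|%:R * chi (jumps Sp) *
  \prod_(j < n | (0 < jump Sp j)%N) int_pos (Y j) (jump Sp j) setT.

(** If [chi (jumps Sp) = 0] the quotient is [0] ([x / 0 = 0]). *)
Definition phi_neg (Sm : spath (N - n)) (Sp : spath n) : R :=
  #|partitions_of Sm|%:R * (chi (jumps Sp ++ jumps Sm) / chi (jumps Sp)) *
  \prod_(j < N - n | (0 < jump Sm j)%N) int_neg (Z j) (jump Sm j) setT.

(** The laws [H_j^+] and [H_j^-], for a jump of size [e] at [j]. *)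
Definition law_U (j : 'I_n) (e : nat) (A : set R) : R :=
  int_pos (Y j) e A / int_pos (Y j) e setT.

Definition law_V (j : 'I_(N - n)) (e : nat) (A : set R) : R :=
  int_neg (Z j) e A / int_neg (Z j) e setT.

(** The latent vectors whose pair of paths is [(Sm, Sp)]. *)
Definition paths_event (Sm : spath (N - n)) (Sp : spath n) :
    set ('I_N -> R) :=
  [set x | corresponds (label_partition posZ x) Sm /\
           corresponds (label_partition posY x) Sp].

(** The positive (negative) unique values are exactly the [U_j] ([V_j]) and
    there are [N(S^+)] ([N(S^-)]) of them. The label [j] belongs to the cell of
    which it is the maximal element, so [U_j = x (posY j)], [V_j = x (posZ j)]. *)
Definition unique_values_event (Sm : spath (N - n)) (Sp : spath n) :
    set ('I_N -> R) :=
  [set x |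
    let pos_values := undup [seq x k | k <- enum 'I_N & 0 < x k] in
    let neg_values := undup [seq x k | k <- enum 'I_N & x k < 0] in
    [/\ size pos_values = n_cells Sp,
        size neg_values = n_cells Sm,
        perm_eq pos_values
          [seq x (posY j) | j <- enum 'I_n & (0 < jump Sp j)%N]
      & perm_eq neg_values
          [seq x (posZ j) | j <- enum 'I_(N - n) & (0 < jump Sm j)%N]]].

(** [U_j \in A_j] and [V_j \in B_j] for all [j] where the path jumps. *)
Definition UV_event (Sm : spath (N - n)) (Sp : spath n)
    (A : 'I_n -> set R) (B : 'I_(N - n) -> set R) : set ('I_N -> R) :=
  [set x | (forall j, (0 < jump Sp j)%N -> A j (x (posY j))) /\
           (forall j, (0 < jump Sm j)%N -> B j (x (posZ j)))].

End Posterior.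

(* Main.v *)
Require Import Defs.
From HB Require Import structures.
From mathcomp Require Import all_boot all_order all_algebra.
From mathcomp Require Import all_classical all_reals all_analysis.
From mathcomp Require Import measurable_realfun ring.

Set Implicit Arguments.
Unset Strict Implicit.
Unset Printing Implicit Defensive.

Import Order.TTheory GRing.Theory Num.Theory.
Import numFieldNormedType.Exports.

Local Open Scope classical_set_scope.
Local Open Scope ring_scope.

(** Why the theorem holds. Integrating out the random law [G] leaves two facts
    about the latent values. First, given the latent values, the observations
    are independent with the densities [kern theta (X k)] ([latent_law]): the
    model states this on rectangles in conditional form, and it extends from
    indicators to functions one coordinate at a time ([cond_independent_prod]).
    Tonelli's theorem on tuples then exhibits the joint density of latent values
    and observations ([joint_density]), and Bayes' formula is the division of
    this density by its marginal ([bayes_version]).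

    Second, the latent values are a mixture over the partitions [p] of the
    labels, with weights [chi (cell_sizes p)], of vectors with one value per
    cell, drawn independently from [H]. As [H] has no atoms, the vector of the
    component [p] almost surely induces the partition [p] itself, so that
    restricting to an event about the induced partition selects components of
    the mixture, and in each component a product of functions of the single
    coordinates integrates to a product over the cells
    ([integral_sample_coincidences]).

    Applied to the likelihood, this makes the Bayes numerator a finite sum over
    partitions. A cell containing labels of both signs contributes zero. A cell
    of positive labels, of size [e] and with maximum [j], contributes the
    integral of [u ^- e] over [u >= Y_j], because the observations increase with
    their labels and the constraint of the largest one implies the others
    ([integral_cell_pos]); negative labels are symmetric. Hence the contribution
    depends on the partition through its two paths only, and the partitions
    without mixed cells that have given paths are glued from two partitions
    counted by [partitions_of] ([bayes_num_paths]). Since every partition has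
    exactly one path on each side, the sum over the pairs of paths is the
    marginal density ([marginal_density_paths]). This gives (i), where a vanishing denominator in
    [phi_neg] is harmless because [chi] does not increase when further draws are
    added ([chi_cat_le]). Requiring in addition that the unique values lie in
    given sets only changes the domains of the one-dimensional integrals, and
    the quotient is the product in (ii). *)

(** * Measures: induction on functions, densities, rectangles *)

Section FunctionInduction.
Context d (T : measurableType d) (R : realType).
Import HBNNSimple.

(** The measure-theoretic induction: two expressions that are additive,
    homogeneous and continuous along increasing sequences agree on all
    nonnegative functions as soon as they agree on indicators, since every
    nonnegative measurable function is an increasing limit of simple ones. *)
Lemma ge0_measurable_fun_ind (Pr : (T -> \bar R) -> Prop) :
  (forall A, measurable A -> Pr (EFin \o \1_A)) ->
  (forall (k : R) (f : T -> \bar R), 0 <= k -> measurable_fun setT f -> (forall x, 0 <= f x)%E ->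
    Pr f -> Pr (fun x => k%:E * f x)%E) ->
  (forall f g : T -> \bar R, measurable_fun setT f -> measurable_fun setT g ->
    (forall x, 0 <= f x)%E -> (forall x, 0 <= g x)%E ->
    Pr f -> Pr g -> Pr (f \+ g)%E) ->
  (forall f_ : nat -> T -> \bar R, (forall n, measurable_fun setT (f_ n)) ->
    (forall n x, 0 <= f_ n x)%E ->
    (forall x, nondecreasing_seq (f_^~ x)) -> (forall n, Pr (f_ n)) ->
    Pr (fun x => limn (f_^~ x))) ->
  forall f : T -> \bar R, measurable_fun setT f -> (forall x, 0 <= f x)%E -> Pr f.
Proof.
move=> Pind Pscale Padd Plim f mf f0.
pose f_ := nnsfun_approx measurableT mf.
have -> : f = fun x => limn (fun n => (f_ n x)%:E).
  by apply/funext => x; apply/esym/cvg_lim => //; exact: cvg_nnsfun_approx.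
apply: (Plim (fun n x => (f_ n x)%:E)).
- by move=> n; exact/measurable_EFinP.
- by move=> n x; rewrite lee_fin.
- by move=> x m n mn; rewrite lee_fin; exact/lefP/nd_nnsfun_approx.
move=> n; rewrite (_ : (fun x => _) =
    (fun x => \sum_(y <- finmap.enum_fset (fset_set (range (f_ n))))
       (y%:E * (EFin \o \1_(f_ n @^-1` [set y])) x))%E); last first.
  apply/funext => x; rewrite fimfunE -fsumEFin// fsbig_finite//=.
have : {in finmap.enum_fset (fset_set (range (f_ n))), forall y, 0 <= y}.
  by move=> y; rewrite in_fset_set// inE => -[x _ <-].
elim: (finmap.enum_fset _) => [_|y s ih ys0].
  rewrite (_ : (fun _ => _) = (fun x => 0%:E * (EFin \o \1_(set0 : set T)) x)%E); last first.
    by apply/funext => x; rewrite big_nil mul0e.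
  apply: Pscale => //.
  - exact/measurable_EFinP/measurable_indic.
  - by move=> x; rewrite lee_fin.
  - exact: Pind.
have m1 z : measurable_fun setT (EFin \o \1_(f_ n @^-1` [set z]) : T -> \bar R).
  by apply/measurable_EFinP/measurable_indic;
    rewrite -[X in measurable X]setTI; exact: measurable_funP.
rewrite (_ : (fun _ => _) = ((fun x => y%:E * (EFin \o \1_(f_ n @^-1` [set y])) x) \+
   (fun x => \sum_(y <- s) y%:E * (EFin \o \1_(f_ n @^-1` [set y])) x))%E); last first.
  by apply/funext => x; rewrite big_cons.
have y0 : 0 <= y by apply: ys0; rewrite mem_head.
have s0 z : z \in s -> 0 <= z by move=> zs; apply: ys0; rewrite inE zs orbT.
apply: Padd.
- exact: measurable_funeM.
- by apply: emeasurable_sum => z; exact: measurable_funeM.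
- by move=> x; rewrite mule_ge0// lee_fin.
- move=> x; rewrite big_seq; apply: sume_ge0 => z zs.
  by rewrite mule_ge0// lee_fin// s0.
- apply: Pscale => //; first by move=> x; rewrite lee_fin.
  by apply: Pind; rewrite -[X in measurable X]setTI; exact: measurable_funP.
- exact: ih.
Qed.

End FunctionInduction.

Section Density.
Local Open Scope ereal_scope.
Context d (T : measurableType d) (R : realType) (mu : {measure set T -> \bar R}).
Variables (f : T -> \bar R) (mf : measurable_fun setT f) (f0 : forall x, 0 <= f x).

(** The proofs that [f] is measurable and nonnegative are arguments so that the
    measure structure below can be inferred from the name. *)
Definition density_measure of measurable_fun setT f & (forall x, 0 <= f x) :=
  fun A : set T => \int[mu]_(x in A) f x.
Local Notation nu := (density_measure mf f0).

Let nu0 : nu set0 = 0. Proof. exact: integral_set0. Qed.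
Let nu_ge0 A : 0 <= nu A. Proof. exact: integral_ge0. Qed.
Let nu_sigma_additive : semi_sigma_additive nu.
Proof.
move=> F mF tF mUF; rewrite /density_measure ge0_integral_bigcup//; last exact: measurable_funTS.
by apply: is_cvg_nneseries => n _ _; exact: integral_ge0.
Qed.

HB.instance Definition _ :=
  isMeasure.Build _ _ _ nu nu0 nu_ge0 nu_sigma_additive.

End Density.

Section DensityIntegral.
Local Open Scope ereal_scope.
Context d (T : measurableType d) (R : realType) (mu : {measure set T -> \bar R}).
Variables (f : T -> \bar R) (mf : measurable_fun setT f) (f0 : forall x, 0 <= f x)
  (ffin : forall x, f x \is a fin_num).

Lemma density_measureE A : measurable A ->
  density_measure mu mf f0 A = \int[mu]_x ((\1_A x)%:E * f x).
Proof.
move=> mA; rewrite /density_measure integral_mkcond; apply: eq_integral => x _.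
by rewrite patchE indicE; case: ifP => xA; rewrite ?mul1e ?mul0e.
Qed.

(** Finiteness of the density is what lets the product with a fixed value of it
    pass to increasing limits. *)
Lemma integral_density_measure (h : T -> \bar R) :
  measurable_fun setT h -> (forall x, 0 <= h x) ->
  \int[density_measure mu mf f0]_x h x = \int[mu]_x (h x * f x).
Proof.
move: h; apply: ge0_measurable_fun_ind 
  => [A mA|k h k0 mh h0 hE|h g mh mg h0 g0 hE gE|h mh h0 ndh hE].
- by rewrite integral_indic// setIT; exact: density_measureE.
- rewrite ge0_integralZl// hE -ge0_integralZl//; last 2 first.
  + exact: emeasurable_funM.
  + by move=> x _; rewrite mule_ge0.
  by apply: eq_integral => x _; rewrite muleA.
- rewrite ge0_integralD// hE gE -ge0_integralD//; last 4 first.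
  + by move=> x _; rewrite mule_ge0.
  + exact: emeasurable_funM.
  + by move=> x _; rewrite mule_ge0.
  + exact: emeasurable_funM.
  by apply: eq_integral => x _; rewrite ge0_muleDl.
- rewrite monotone_convergence//.
  under eq_fun do rewrite hE.
  rewrite -monotone_convergence//; last 3 first.
  + by move=> n; exact: emeasurable_funM.
  + by move=> n x _; rewrite mule_ge0.
  + by move=> x _ m n mn; rewrite lee_wpmul2r//; exact: ndh.
  apply: eq_integral => x _; rewrite limeMr//.
  exact/ereal_nondecreasing_is_cvgn/ndh.
Qed.

End DensityIntegral.

Lemma prod_indic (R : realType) (I : finType) (Q : pred I) (T : Type)
    (A : I -> set T) (x : I -> T) (b : bool) :
  reflect (forall i, Q i -> A i (x i)) b ->
  \prod_(i | Q i) (\1_(A i) (x i) : R) = b%:R.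
Proof.
case=> [xA|xA]; first by rewrite big1// => i Qi; rewrite indicE mem_set//; exact: xA.
have [i Qi xi] : exists2 i, Q i & ~ A i (x i).
  apply: contrapT => h; apply: xA => i Qi.
  by apply: contrapT => h'; apply: h; exists i.
by rewrite (bigD1 i)//= indicE memNset// mul0r.
Qed.

Lemma prode_itv01 (R : realType) (I : finType) (Q : pred I) (f : I -> \bar R) :
  (forall i, 0 <= f i <= 1)%E -> (0 <= \prod_(i | Q i) f i <= 1)%E.
Proof.
move=> f01; apply: (big_ind (fun x => 0 <= x <= 1)%E) => //.
  by rewrite lee01 lexx.
move=> x y /andP[x0 x1] /andP[y0 y1]; rewrite mule_ge0//=.
by rewrite -[leRHS]mule1 lee_pmul.
Qed.

Lemma measurable_rectangle d d' (U : measurableType d) (T : measurableType d') n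
    (Y : 'I_n -> U -> T) (A : 'I_n -> set T) :
  (forall i, measurable_fun setT (Y i)) -> (forall i, measurable (A i)) ->
  measurable [set w | forall i, A i (Y i w)].
Proof.
move=> mY mA; rewrite (_ : mkset _ = \big[setI/setT]_(i < n) (Y i @^-1` A i)).
  by apply: bigsetI_measurable => i _; rewrite -[X in measurable X]setTI; exact: mY.
apply/seteqP; split => w; rewrite -bigcap_seq /= => h i; first by move=> _; exact: h.
by apply: h; rewrite /= mem_index_enum.
Qed.

Section TupleUniqueness.
Local Open Scope ereal_scope.
Context d (T : measurableType d) (R : realType) (n : nat).

Definition tuple_box (A : 'I_n -> set T) : set (n.-tuple T) :=
  [set u | forall i, A i (tnth u i)].

Lemma measurable_tuple_box A : (forall i, measurable (A i)) ->
  measurable (tuple_box A).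
Proof.
by move=> mA; apply: measurable_rectangle => // i; exact: measurable_tnth.
Qed.

(** Rectangles are stable under intersection and generate the product
    sigma-algebra of tuples. *)
Lemma tuple_measure_unique (m1 m2 : {measure set (n.-tuple T) -> \bar R}) :
  m1 setT < +oo ->
  (forall A, (forall i, measurable (A i)) -> m1 (tuple_box A) = m2 (tuple_box A)) ->
  forall D, measurable D -> m1 D = m2 D.
Proof.
move=> m1oo m12.
pose B : set (set (n.-tuple T)) :=
  [set D | exists2 A, (forall i, measurable (A i)) & D = tuple_box A].
apply: (measure_unique B (fun=> setT)).
- apply/seteqP; split.
    apply: sub_sigma_algebra2 => D; rewrite -bigcup_seq => -[i _ [A mA <-]].
    exists (fun j => if j == i then A else setT).
      by move=> j; case: ifP.
    rewrite setTI; apply/seteqP; split => u; rewrite /tuple_box/=.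
      by move=> Au j; case: eqP => [->|].
    by move=> /(_ i); rewrite eqxx.
  apply: smallest_sub; first exact: sigma_algebra_measurable.
  by move=> D [A mA ->]; exact: measurable_tuple_box.
- move=> _ _ [A1 mA1 ->] [A2 mA2 ->]; exists (fun i => A1 i `&` A2 i).
    by move=> i; exact: measurableI.
  apply/seteqP; split => u; rewrite /tuple_box/=.
    by move=> [h1 h2] i; split.
  by move=> h; split => i; have [] := h i.
- by move=> _; exists (fun=> setT) => //; apply/seteqP; split.
- by apply/seteqP; split => // x _; exists 0%N.
- by move=> _ [A mA ->]; exact: m12.
- by [].
Qed.

End TupleUniqueness.

(** * Power measures on tuples *)

Section ImageMeasure.
Local Open Scope ereal_scope.
Context d1 d2 (T1 : measurableType d1) (T2 : measurableType d2) (R : realType)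
  (f : T1 -> T2) (mf : measurable_fun setT f) (m : {measure set T1 -> \bar R}).

(** Same encoding as [density_measure]: the measurability proof is an argument so
    that the measure structure can be inferred. *)
Definition image_measure of measurable_fun setT f := pushforward m f.
Local Notation im := (image_measure mf).

Let im0 : im set0 = 0. Proof. exact: measure0. Qed.
Let im_ge0 A : 0 <= im A. Proof. exact: measure_ge0. Qed.
Let im_sigma_additive : semi_sigma_additive im.
Proof. exact: measure_semi_sigma_additive. Qed.

HB.instance Definition _ :=
  isMeasure.Build _ _ _ im im0 im_ge0 im_sigma_additive.

Lemma integral_image_measure (g : T2 -> \bar R) :
  measurable_fun setT g -> (forall y, 0 <= g y) ->
  \int[im]_y g y = \int[m]_x g (f x).
Proof. by move=> mg g0; rewrite ge0_integral_pushforward. Qed.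

End ImageMeasure.

Section EmeasurableProd.
Local Open Scope ereal_scope.
Context d (T : measurableType d) (R : realType).

Lemma emeasurable_prod D (I : Type) (s : seq I) (P : pred I) (h : I -> T -> \bar R) :
  (forall i, measurable_fun D (h i)) ->
  measurable_fun D (fun x => \prod_(i <- s | P i) h i x).
Proof.
move=> mh; elim: s => [|i s ih].
  by under eq_fun do rewrite big_nil; exact: measurable_cst.
(under eq_fun do rewrite big_cons); case: (P i) => //.
exact: emeasurable_funM.
Qed.

End EmeasurableProd.

Section TupleCons.
Local Open Scope ereal_scope.
Context d (T : measurableType d) (R : realType).
Context (n : nat) (mu : {sigma_finite_measure set T -> \bar R})
  (M : {sigma_finite_measure set (n.-tuple T) -> \bar R}).

Definition tuple_cons (z : T * n.-tuple T) : n.+1.-tuple T :=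
  [tuple of z.1 :: z.2].

Lemma measurable_tuple_cons : measurable_fun setT tuple_cons.
Proof. exact: measurable_cons. Qed.

Definition cons_measure := image_measure (mu \x M) measurable_tuple_cons.

HB.instance Definition _ := Measure.on cons_measure.

Let cons_measure_sigma_finite : sigma_finite setT cons_measure.
Proof.
have /sigma_finiteP[F [TF ndF mF]] := sigma_finiteT mu.
have /sigma_finiteP[F' [TF' ndF' mF']] := sigma_finiteT M.
pose uncons (u : n.+1.-tuple T) := (thead u, [tuple of behead u]).
have muncons : measurable_fun setT uncons.
  apply: measurable_fun_pair; first exact: measurable_tnth.
  exact: measurable_behead.
have K z : uncons (tuple_cons z) = z.
  by case: z => x u; rewrite /uncons /tuple_cons theadE; congr pair; exact/val_inj.
exists (fun k => uncons @^-1` (F k `*` F' k)).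
  rewrite -preimage_bigcup (_ : \bigcup_k _ = setT) ?preimage_setT//.
  apply/seteqP; split => // -[x s] _.
  have [i _ Fx] : (\bigcup_k F k) x by rewrite -TF.
  have [j _ Fs] : (\bigcup_k F' k) s by rewrite -TF'.
  exists (maxn i j) => //; split => /=.
    by move: x Fx; exact/subsetPset/ndF/leq_maxl.
  by move: s Fs; exact/subsetPset/ndF'/leq_maxr.
move=> k; have [mFk Fkoo] := mF k; have [mFk' Fkoo'] := mF' k; split.
  by rewrite -[X in measurable X]setTI; apply: muncons => //; exact: measurableX.
rewrite /cons_measure /image_measure /pushforward /=.
rewrite (_ : _ @^-1` _ = F k `*` F' k).
  by rewrite product_measure1E// lte_mul_pinfty// ge0_fin_numE.
by rewrite -comp_preimage (_ : _ \o _ = id)//; apply/funext => z; exact: K.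
Qed.

HB.instance Definition _ := Measure_isSigmaFinite.Build _ _ _ cons_measure
  cons_measure_sigma_finite.

Lemma integral_cons_measure (g : n.+1.-tuple T -> \bar R) :
  measurable_fun setT g -> (forall y, 0 <= g y) ->
  \int[cons_measure]_u g u = \int[M]_s \int[mu]_x g (tuple_cons (x, s)).
Proof.
move=> mg g0; rewrite integral_image_measure// fubini_tonelli2//.
by apply: measurableT_comp => //; exact: measurable_tuple_cons.
Qed.

End TupleCons.

Section ProductMeasure.
Local Open Scope ereal_scope.
Context d (T : measurableType d) (R : realType).

(** The power of [mu] on [n]-tuples, built one coordinate at a time so that
    Tonelli's theorem for pairs gives Tonelli's theorem for tuples by induction.
    Sigma-finiteness, rather than finiteness, is needed for Lebesgue measure. *)
Fixpoint product_measure (mu : {sigma_finite_measure set T -> \bar R}) (n : nat) :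
    {sigma_finite_measure set (n.-tuple T) -> \bar R} :=
  match n return {sigma_finite_measure set (n.-tuple T) -> \bar R} with
  | 0%N => \d_([tuple] : 0.-tuple T)
  | n'.+1 => cons_measure mu (product_measure mu n')
  end.

Lemma integral_product_measure mu n (f : 'I_n -> T -> \bar R) :
  (forall i, measurable_fun setT (f i)) -> (forall i x, 0 <= f i x) ->
  \int[product_measure mu n]_u (\prod_(i < n) f i (tnth u i)) =
  \prod_(i < n) \int[mu]_x f i x.
Proof.
have mprod m (g : 'I_m -> T -> \bar R) (P : pred 'I_m) : (forall i, measurable_fun setT (g i)) ->
    measurable_fun setT (fun u : m.-tuple T => \prod_(i < m | P i) g i (tnth u i)).
  move=> mg; apply: emeasurable_prod => i.
  by apply: measurableT_comp => //; exact: measurable_tnth.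
elim: n f => [|n ih] f mf f0.
  under eq_integral do rewrite big_ord0.
  by rewrite integral_cst//= diracT big_ord0 mule1.
rewrite /= integral_cons_measure//; first last.
- by move=> u; apply: prode_ge0.
- exact: mprod.
under eq_integral => s _.
  under eq_integral => x _ do rewrite big_ord_recl tnth0.
  under eq_integral => x _ do under eq_bigr do rewrite tnthS.
  rewrite /= ge0_integralZr//; last by apply: prode_ge0.
  over.
rewrite ge0_integralZl//; last 3 first.
- exact: (mprod n (fun i => f (lift ord0 i)) xpredT).
- by move=> s _; exact: prode_ge0.
- by apply: integral_ge0.
by rewrite big_ord_recl (ih (fun i => f (lift ord0 i))).
Qed.

End ProductMeasure.

(** * Coincidences between coordinates *)

Section Coincidences.
Local Open Scope ereal_scope.
Context (R : realType).
Local Notation T := (measurableTypeR R).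

(** Which coordinates of [x] are equal. The partition of the labels induced by a
    sample depends on the sample only through this finite datum, which makes all
    events about partitions finite unions of events of a single kind. *)
Definition coincidences n (x : 'I_n -> R) : {ffun 'I_n * 'I_n -> bool} :=
  [ffun ij => x ij.1 == x ij.2].

Lemma measurable_coincidences n (Q : pred {ffun 'I_n * 'I_n -> bool}) :
  measurable [set u : n.-tuple T | Q (coincidences (tnth u))].
Proof.
have mc r : measurable [set u : n.-tuple T | coincidences (tnth u) = r].
  rewrite (_ : mkset _ = \big[setI/setT]_(ij : 'I_n * 'I_n)
      [set u | (tnth u ij.1 == tnth u ij.2) = r ij]); last first.
    apply/seteqP; split => u; rewrite -bigcap_seq /=.
      by move=> <- ij _ /=; rewrite ffunE.
    by move=> h; apply/ffunP => ij; rewrite ffunE h//= mem_index_enum.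
  apply: bigsetI_measurable => ij _.
  have m0 : measurable [set u : n.-tuple T | tnth u ij.1 == tnth u ij.2].
    have mB : measurable_fun setT (fun u : n.-tuple T => (tnth u ij.1 - tnth u ij.2 : R)%R).
      by apply: measurable_funB; exact: measurable_tnth.
    rewrite (_ : mkset _ = (fun u : n.-tuple T => (tnth u ij.1 - tnth u ij.2)%R) @^-1` [set 0%R]).
      by rewrite -[X in measurable X]setTI; exact: mB.
    by apply/seteqP; split => u /=; rewrite -subr_eq0 => /eqP.
  case: (r ij) => //; rewrite (_ : mkset _ = ~` [set u : n.-tuple T | tnth u ij.1 == tnth u ij.2]).
    exact: measurableC.
  by apply/seteqP; split => u /=; [move=> ->|move/negP/negbTE].
rewrite (_ : mkset _ = \big[setU/set0]_(r | Q r) [set u | coincidences (tnth u) = r]).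
  by apply: bigsetU_measurable => r _.
apply/seteqP; split => u; rewrite -bigcup_seq_cond /=.
  by move=> Qu; exists (coincidences (tnth u)) => //=; rewrite mem_index_enum.
by move=> [r /= /andP[_ Qr] ->].
Qed.

Lemma measurable_uniq n : measurable [set u : n.-tuple T | uniq u].
Proof.
pose Q (r : {ffun 'I_n * 'I_n -> bool}) := [forall i, forall j, r (i, j) ==> (i == j)].
rewrite (_ : mkset _ = [set u : n.-tuple T | Q (coincidences (tnth u))]).
  exact: measurable_coincidences.
apply/seteqP; split => u /=.
  move=> /tuple_uniqP uu; apply/forallP => i; apply/forallP => j.
  by rewrite ffunE; apply/implyP => /= /eqP /uu ->.
move=> /forallP h; apply/tuple_uniqP => i j uij.
by move: (h i) => /forallP/(_ j); rewrite ffunE /= uij eqxx => /eqP.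
Qed.

(** Adding a coordinate to a tuple without repetition creates a repetition only
    if the new value is one of finitely many, and a non-atomic measure does not
    charge finite sets. *)
Lemma product_measure_not_uniq (mu : {sigma_finite_measure set T -> \bar R}) n :
  (forall x, mu [set x] = 0) ->
  product_measure mu n [set u : n.-tuple T | ~~ uniq u] = 0.
Proof.
move=> mu0.
have mN m : measurable [set u : m.-tuple T | ~~ uniq u].
  rewrite (_ : mkset _ = ~` [set u : m.-tuple T | uniq u]).
    by apply: measurableC; exact: measurable_uniq.
  by apply/seteqP; split => u /= /negP.
elim: n => [|n ih].
  rewrite (_ : mkset _ = set0) ?measure0//.
  by apply/seteqP; split => // u; rewrite (tuple0 u).
rewrite -[X in product_measure _ _ X](setIT) -integral_indic//; last exact: mN.
rewrite [LHS](integral_cons_measure mu (product_measure mu n)); last 2 first.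
- by apply/measurable_EFinP; apply: measurable_indic; exact: mN.
- by move=> u; rewrite lee_fin.
set F := fun s => \int[mu]_x _.
have mF : measurable_fun setT F.
  apply: (@measurable_fun_fubini_tonelli_G _ _ _ _ _ mu
    (fun z => (\1_[set u : n.+1.-tuple T | ~~ uniq u] (tuple_cons z))%:E)) => //.
  apply/measurable_EFinP; apply: measurableT_comp; last exact: measurable_tuple_cons.
  by apply: measurable_indic; exact: mN.
have F0 s : 0 <= F s by apply: integral_ge0.
have -> : \int[product_measure mu n]_s F s = \int[product_measure mu n]_s (cst 0) s.
  apply: ge0_ae_eq_integral => //.
  exists [set u : n.-tuple T | ~~ uniq u]; split; [exact: mN|exact: ih|].
  move=> s /= Fs; apply/negP => us; apply: Fs => _.
  rewrite /F.
  rewrite (_ : (fun _ => _) = EFin \o \1_[set x | x \in tval s]); last first.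
    apply/funext => x /=; congr EFin; rewrite !indicE; congr (nat_of_bool _)%:R.
    by apply/idP/idP; rewrite !inE/= us andbT negbK.
  have ms : forall l : seq R, measurable [set x : T | x \in l] /\ mu [set x | x \in l] = 0.
    elim => [|y l [ml ihl]].
      by rewrite (_ : mkset _ = set0) ?measure0; [split|apply/seteqP; split].
    rewrite (_ : mkset _ = [set y] `|` [set x | x \in l]).
      by split; [exact: measurableU|rewrite measureU0//; exact: mu0].
    by apply/seteqP; split => x /=; rewrite inE;
      [move=> /orP[/eqP ->|]; [left|right]|move=> [->|->]; rewrite ?eqxx ?orbT].
  by rewrite integral_indic ?setIT; have [] := ms s.
by rewrite integral0.
Qed.

End Coincidences.

(** * Samples with i.i.d. values on the cells of a random partition *)

Section Transversal.
Variables (I : finType) (p : {set {set I}}).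
Hypothesis pT : finset.partition p [set: I]%SET.

Lemma mem_pblockT i : i \in finset.pblock p i.
Proof. by rewrite mem_pblock (cover_partition pT) inE. Qed.

Lemma pblockT_mem i : finset.pblock p i \in p.
Proof. by apply: pblock_mem; rewrite (cover_partition pT) inE. Qed.

Lemma pblockT_id C i : C \in p -> i \in C -> finset.pblock p i = C.
Proof. by move=> Cp iC; apply: def_pblock => //; exact: partition_trivIset pT. Qed.

Lemma eq_pblockT i j : (finset.pblock p i == finset.pblock p j) = (j \in finset.pblock p i).
Proof.
apply: eq_pblock; first exact: partition_trivIset pT.
by rewrite (cover_partition pT) inE.
Qed.

(** A product over the cells of a partition becomes a product over a system of
    representatives, described by a predicate [s] that holds at exactly one
    element of each cell. *)
Lemma big_transversal (A : Type) (idx : A) (op : Monoid.com_law idx) (s : pred I)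
    (F : {set I} -> A) :
  (forall C, C \in p -> exists j, forall i, (i \in C) && s i = (i == j)) ->
  \big[op/idx]_(C in p) F C = \big[op/idx]_(j | s j) F (finset.pblock p j).
Proof.
move=> sT; rewrite [RHS](partition_big (finset.pblock p) (mem p)) /=; last first.
  by move=> i _; exact: pblockT_mem.
apply: eq_bigr => C Cp; have [j jC] := sT C Cp.
have /andP[jinC _] : (j \in C) && s j by rewrite jC.
rewrite (big_pred1 j) ?(pblockT_id Cp jinC)// => i /=.
rewrite -jC andbC; case: (s i); rewrite ?andbF// !andbT.
apply/eqP/idP => [<-|iC]; first exact: mem_pblockT.
exact: pblockT_id.
Qed.

Definition cell_rep i : I := odflt i [pick j in finset.pblock p i].

Lemma cell_rep_mem i : cell_rep i \in finset.pblock p i.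
Proof. by rewrite /cell_rep; case: pickP => [j|_] //=; exact: mem_pblockT. Qed.

Lemma eq_cell_rep i j : (cell_rep i == cell_rep j) = (finset.pblock p i == finset.pblock p j).
Proof.
apply/eqP/eqP => [rij|pij].
  have Hi := cell_rep_mem i; have Hj := cell_rep_mem j; rewrite -rij in Hj.
  by rewrite -(pblockT_id (pblockT_mem i) Hi) -(pblockT_id (pblockT_mem j) Hj).
rewrite /cell_rep pij; case: pickP => //= /(_ j).
by rewrite mem_pblockT.
Qed.

Lemma cell_rep_idem i : cell_rep (cell_rep i) = cell_rep i.
Proof.
apply/eqP; rewrite eq_cell_rep; apply/eqP/pblockT_id; first exact: pblockT_mem.
exact: cell_rep_mem.
Qed.

End Transversal.

Section Mixture.
Local Open Scope ereal_scope.
Context (R : realType) (H : probability (measurableTypeR R) R)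
  (H0 : forall x, H [set x] = 0).
Local Notation T := (measurableTypeR R).
Variable m : nat.
Implicit Types (p : {set {set 'I_m}}).

(** The coincidences of a vector that takes distinct values on the cells. *)
Definition same_cell p : {ffun 'I_m * 'I_m -> bool} :=
  [ffun ij => finset.pblock p ij.1 == finset.pblock p ij.2].

(** Copies one coordinate of [u] per cell to the whole cell: if [u] is i.i.d.
    from [H], then [relabel p u] has one independent value per cell of [p]. *)
Definition relabel p (u : m.-tuple T) : m.-tuple T :=
  [tuple tnth u (cell_rep p i) | i < m].

Lemma measurable_relabel p : measurable_fun setT (relabel p).
Proof.
apply/measurable_fun_tnthP => i.
rewrite (_ : _ \o _ = (@tnth _ T)^~ (cell_rep p i)); first exact: measurable_tnth.
by apply/funext => u /=; rewrite tnth_mktuple.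
Qed.

(** The coordinates that represent no cell do not occur in the integrand and
    integrate to one, since [H] is a probability. *)
Lemma integral_relabel_prod p (f : 'I_m -> T -> \bar R) :
  finset.partition p [set: 'I_m]%SET ->
  (forall i, measurable_fun setT (f i)) -> (forall i x, 0 <= f i x) ->
  \int[product_measure H m]_u (\prod_(i < m) f i (tnth (relabel p u) i)) =
  \prod_(C in p) \int[H]_x \prod_(i in C) f i x.
Proof.
move=> pT mf f0.
transitivity (\int[product_measure H m]_u (\prod_(j < m)
   (fun x => \prod_(i | cell_rep p i == j) f i x) (tnth u j))).
  apply: eq_integral => u _; rewrite (partition_big (cell_rep p) predT) //=.
  apply: eq_bigr => j _; apply: eq_bigr => i /eqP <-.
  by rewrite tnth_mktuple.
rewrite (integral_product_measure H (f := fun j x => \prod_(i | cell_rep p i == j) f i x));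
  last 2 first.
- by move=> j; exact: emeasurable_prod.
- by move=> j x; exact: prode_ge0.
rewrite (big_transversal pT _ (s := fun j => cell_rep p j == j)); last first.
  move=> C Cp; have [i iC] : exists i, i \in C.
    by apply/set0Pn; apply: contraTneq Cp => ->; have /and3P[] := pT.
  exists (cell_rep p i) => j; apply/andP/eqP => [[jC /eqP <-]|->].
    by apply/eqP; rewrite eq_cell_rep// (pblockT_id pT Cp jC) (pblockT_id pT Cp iC).
  split; last by rewrite cell_rep_idem.
  by rewrite -(pblockT_id pT Cp iC) cell_rep_mem.
rewrite [RHS]big_mkcond /=; apply: eq_bigr => j _; case: ifPn => [/eqP jj|jj].
  apply: eq_integral => x _; apply: eq_bigl => i.
  by rewrite -{1}jj eq_cell_rep// eq_sym eq_pblockT.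
under eq_integral => x _.
  rewrite big_pred0; last first.
    by move=> i; apply: contraNF jj => /eqP <-; rewrite cell_rep_idem.
  over.
by rewrite integral_cst// mul1e; exact: probability_setT.
Qed.

Context d (Omega : measurableType d) (P : probability Omega R)
  (X : 'I_m -> {RV P >-> T}) (c : {set {set 'I_m}} -> R)
  (c0 : forall p, finset.partition p [set: 'I_m]%SET -> (0 <= c p)%R).

Hypothesis X_law : forall A : 'I_m -> set T, (forall i, measurable (A i)) ->
  P [set w | forall i, A i (X i w)] =
  \sum_(p : {set {set 'I_m}} | finset.partition p [set: 'I_m]%SET) (c p)%:E *
    \prod_(C in p) H (\bigcap_(i in [set i | i \in C]) A i).

Definition sample w : m.-tuple T := [tuple X i w | i < m].

Lemma measurable_sample : measurable_fun setT sample.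
Proof.
apply/measurable_fun_tnthP => i.
rewrite (_ : _ \o _ = X i) //.
by apply/funext => u /=; rewrite tnth_mktuple.
Qed.

Let ps := [seq p <- enum {: {set {set 'I_m}}} | finset.partition p [set: 'I_m]%SET].
Let pk k := nth finset.set0 ps k.
Let ck_ge0 k : (0 <= if (k < size ps)%N then c (pk k) else 0)%R.
Proof.
case: ifP => // kp; apply: c0.
by have := mem_nth finset.set0 kp; rewrite mem_filter => /andP[].
Qed.

Let component k : {measure set (m.-tuple T) -> \bar R} :=
  mscale (NngNum (ck_ge0 k)) (image_measure (product_measure H m) (measurable_relabel (pk k))).

Let mixture : {measure set (m.-tuple T) -> \bar R} := msum component (size ps).

Let sum_ps (F : {set {set 'I_m}} -> \bar R) :
  \sum_(k < size ps) (if (k < size ps)%N then c (pk k) else 0)%:E * F (pk k) =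
  \sum_(p | finset.partition p [set: 'I_m]%SET) (c p)%:E * F p.
Proof.
under eq_bigr do rewrite ltn_ord.
rewrite -(big_mkord xpredT (fun k => (c (pk k))%:E * F (pk k))).
rewrite -(big_nth finset.set0 xpredT (fun p => (c p)%:E * F p)).
by rewrite big_filter big_enum_cond.
Qed.

(** The law of the sample is the mixture, with weights [c p], of the laws of
    [relabel p u] for [u] i.i.d. from [H]: by [X_law] the two agree on
    rectangles. *)
Lemma sample_law_mixture D : measurable D ->
  image_measure P measurable_sample D = mixture D.
Proof.
apply: tuple_measure_unique.
  by rewrite -[X in X < _]/(P setT) probability_setT ltry.
move=> A mA.
transitivity (P [set w | forall i, A i (X i w)]).
  rewrite /image_measure /pushforward; congr (P _).
  by apply/seteqP; split => w /= h i; have := h i; rewrite tnth_mktuple.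
rewrite X_law// -sum_ps; apply: eq_bigr => k _; congr (_ * _).
have ppT : finset.partition (pk k) [set: 'I_m]%SET.
  by have := mem_nth finset.set0 (ltn_ord k); rewrite mem_filter => /andP[].
have mb := measurable_tuple_box mA.
transitivity (\int[product_measure H m]_u
    (\prod_(i < m) (\1_(A i) (tnth (relabel (pk k) u) i))%:E)).
  rewrite (integral_relabel_prod (f := fun i x => (\1_(A i) x)%:E))//; last first.
    by move=> i; apply/measurable_EFinP/measurable_indic.
  apply: eq_bigr => C Cp.
  have mC : measurable (\bigcap_(i in [set i | i \in C]) A i).
    by apply: fin_bigcap_measurable.
  rewrite -[X in H X]setIT -integral_indic//; apply: eq_integral => x _.
  rewrite prodEFin; congr EFin; rewrite indicE.
  apply/esym/(@prod_indic _ _ _ _ _ (fun=> x)).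
  by apply: (iffP idP) => [|h]; rewrite inE.
rewrite -[X in _ = product_measure H m X]setIT -integral_indic//; last first.
  by rewrite -[X in measurable X]setTI; exact: measurable_relabel.
apply: eq_integral => u _; rewrite prodEFin; congr EFin; rewrite indicE; apply: prod_indic.
by apply: (iffP idP) => [|h]; rewrite inE; [move=> h i _; exact: h|move=> i; exact: h].
Qed.

Lemma integral_sample (F : m.-tuple T -> \bar R) :
  measurable_fun setT F -> (forall u, 0 <= F u) ->
  \int[P]_w F (sample w) =
  \sum_(p | finset.partition p [set: 'I_m]%SET)
    (c p)%:E * \int[product_measure H m]_u F (relabel p u).
Proof.
move=> mF F0; rewrite -(integral_image_measure measurable_sample)//.
rewrite (@eq_measure_integral _ _ _ _ mixture); last first.
  by move=> D mD _; exact: sample_law_mixture.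
rewrite ge0_integral_measure_sum// -sum_ps; apply: eq_bigr => k _.
by rewrite ge0_integral_mscale//= integral_image_measure.
Qed.

(** The key formula. Since [H] has no atoms, the component [p] of the mixture
    almost surely has exactly the coincidences prescribed by [p]; restricting to
    a pattern [Q] of coincidences therefore selects components, and within a
    component the integral factors over the cells. *)
Lemma integral_sample_coincidences (Q : pred {ffun 'I_m * 'I_m -> bool})
    (f : 'I_m -> T -> \bar R) :
  (forall i, measurable_fun setT (f i)) -> (forall i x, 0 <= f i x) ->
  \int[P]_w ((Q (coincidences (X^~ w)))%:R%:E * \prod_(i < m) f i (X i w)) =
  \sum_(p | finset.partition p [set: 'I_m]%SET && Q (same_cell p))
    (c p)%:E * \prod_(C in p) \int[H]_x \prod_(i in C) f i x.
Proof.
move=> mf f0.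
pose F (u : m.-tuple T) := ((\1_[set u : m.-tuple T | Q (coincidences (tnth u))] u)%:E *
   \prod_(i < m) f i (tnth u i)).
have mprod : measurable_fun setT (fun u : m.-tuple T => \prod_(i < m) f i (tnth u i)).
  apply: emeasurable_prod => i.
  by apply: measurableT_comp => //; exact: measurable_tnth.
have prod0 (u : m.-tuple T) : 0 <= \prod_(i < m) f i (tnth u i) by exact: prode_ge0.
have mF : measurable_fun setT F.
  apply: emeasurable_funM => //; apply/measurable_EFinP.
  by apply: measurable_indic; exact: measurable_coincidences.
have F0 u : 0 <= F u by rewrite mule_ge0// lee_fin.
transitivity (\int[P]_w F (sample w)).
  apply: eq_integral => w _; congr (_ * _); last first.
    by apply: eq_bigr => i _; rewrite tnth_mktuple.
  rewrite indicE mem_setE /in_mem /=.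
  suff -> : coincidences (tnth (sample w)) = coincidences (X^~ w) by [].
  by apply/ffunP => ij; rewrite !ffunE !tnth_mktuple.
rewrite integral_sample// [RHS]big_mkcondr /=; apply: eq_bigr => p pT.
have coinc u : uniq (tval u) -> coincidences (tnth (relabel p u)) = same_cell p.
  move=> /tuple_uniqP u_inj; apply/ffunP => ij; rewrite !ffunE !tnth_mktuple.
  by rewrite (inj_eq u_inj) eq_cell_rep.
transitivity ((c p)%:E * \int[product_measure H m]_u
    ((Q (same_cell p))%:R%:E * \prod_(i < m) f i (tnth (relabel p u) i))).
  congr (_ * _); apply: ge0_ae_eq_integral => //.
  - by apply: measurableT_comp => //; exact: measurable_relabel.
  - apply: emeasurable_funM => //.
    by apply: (measurableT_comp mprod); exact: measurable_relabel.
  - by move=> u _; rewrite mule_ge0// lee_fin.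
  exists [set u : m.-tuple T | ~~ uniq u]; split.
  - rewrite (_ : mkset _ = ~` [set u : m.-tuple T | uniq u]).
      by apply: measurableC; exact: measurable_uniq.
    by apply/seteqP; split => u /= /negP.
  - exact: product_measure_not_uniq.
  move=> u /= Fu; apply/negP => uu; apply: Fu => _.
  by rewrite /F indicE mem_setE /in_mem /= coinc.
case: ifP => _; last first.
  rewrite (_ : (fun _ => _) = cst 0) ?integral0 ?mule0//.
  by apply/funext => u; rewrite mul0e.
by under eq_integral do rewrite mul1e; rewrite integral_relabel_prod.
Qed.

End Mixture.

(** * The conditional density of an observation *)

Section Kern.
Context (R : realType) (theta : R).
Local Notation T := (measurableTypeR R).

Lemma kern_pos (x t : R) : 0 < t - theta ->
  kern theta x t = x^-1 * (t - theta <= x)%R%:R.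
Proof. by move=> t0; rewrite /kern t0 /= (ltNge (t - theta)) (ltW t0) andbF subr0. Qed.

Lemma kern_neg (x t : R) : t - theta < 0 ->
  kern theta x t = (- x)^-1 * (x <= t - theta)%R%:R.
Proof.
move=> t0; rewrite /kern t0 andbT ltNge (ltW t0) /= sub0r.
by rewrite invrN mulrN mulNr.
Qed.

Lemma kern_ge0 (x t : R) : 0 <= kern theta x t.
Proof.
have [t0|t0|t0] := ltgtP (t - theta) 0.
- rewrite kern_neg//; case: (leP x) => xt; rewrite ?mulr0// mulr1 invr_ge0 oppr_ge0.
  by rewrite (le_trans xt)// ltW.
- rewrite kern_pos//; case: (leP _ x) => xt; rewrite ?mulr0// mulr1 invr_ge0.
  by rewrite (le_trans _ xt)// ltW.
- by rewrite /kern t0 ltxx andbF subr0 mulr0.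
Qed.

Lemma kern_le (x t : R) : kern theta x t <= `|t - theta|^-1.
Proof.
have [t0|t0|t0] := ltgtP (t - theta) 0.
- rewrite kern_neg//; case: (leP x) => xt; rewrite ?mulr1 ?mulr0 ?invr_ge0// ltr0_norm//.
  by rewrite lef_pV2 ?posrE ?oppr_gt0 ?lerN2 //; exact: le_lt_trans t0.
- rewrite kern_pos//; case: (leP _ x) => xt; rewrite ?mulr1 ?mulr0 ?invr_ge0// gtr0_norm//.
  by rewrite lef_pV2 ?posrE//; exact: lt_le_trans xt.
- by rewrite /kern t0 ltxx andbF subr0 mulr0 invr_ge0.
Qed.

Lemma measurable_inv d (S : measurableType d) (f : S -> R) :
  measurable_fun setT f -> measurable_fun setT (fun x => (f x)^-1).
Proof.
(* [y^-1 = y * (y^2)^-1] also at [y = 0], and real powers are measurable *)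
move=> mf; rewrite (_ : (fun x => _) = fun x => f x * powR (f x ^+ 2) (-1)).
  apply: measurable_funM => //.
  apply: (measurableT_comp (f := fun y : R => powR y (-1))); first exact: measurable_powR.
  exact: measurable_funX.
apply/funext => x; rewrite powR_inv1 ?sqr_ge0// expr2.
by have [->|fx0] := eqVneq (f x) 0; rewrite ?mul0r ?invr0// invfM mulrA mulfV// mul1r.
Qed.

Lemma measurable_boolr d (S : measurableType d) (b : S -> bool) :
  measurable_fun setT b -> measurable_fun setT (fun x => (b x)%:R : R).
Proof.
move=> mb; rewrite (_ : (fun x => _) = fun x => if b x then 1 else 0 : R).
  exact: measurable_fun_ifT.
by apply/funext => x; case: (b x).
Qed.

Lemma measurable_kern2 d (S : measurableType d) (x t : S -> R) :
  measurable_fun setT x -> measurable_fun setT t ->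
  measurable_fun setT (fun s => kern theta (x s) (t s)).
Proof.
move=> mx mt; rewrite /kern; apply: measurable_funM; first exact: measurable_inv.
have mtt : measurable_fun setT (fun s => t s - theta) by exact: measurable_funB.
by apply: measurable_funB; apply: measurable_boolr; apply: measurable_and;
  do ?[exact: measurable_fun_ltr|exact: measurable_fun_ler].
Qed.

(** At [x = 0] the kernel vanishes because [0^-1 = 0], so that it is a density in
    [t] for every other [x] only. *)
Lemma integral_kern (x : R) :
  (\int[@lebesgue_measure R]_t (kern theta x t)%:E = (x != 0)%:R%:E)%E.
Proof.
have [x0|x0|->] := ltgtP x 0.
- rewrite (_ : (fun t => _) = fun t => ((- x)^-1 * \1_(`[theta + x, theta[) t)%:E); last first.
    apply/funext => t; congr EFin; rewrite /kern indicE mem_setE in_itv/=.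
    rewrite lerBrDl subr_lt0 subr_gt0.
    have [tt|tt] := ltP theta t.
      rewrite andbC lerBlDl (leNgt t) (lt_trans _ tt)/= ?gtrDl//.
      by rewrite (ltNge t) (ltW tt)/= !andbF subrr !mulr0.
    by rewrite /= sub0r mulrN invrN mulNr.
  under eq_integral do rewrite EFinM.
  rewrite ge0_integralZl//; last 2 first.
  - by apply/measurable_EFinP/measurable_indic.
  - by rewrite lee_fin invr_ge0 oppr_ge0 ltW.
  rewrite integral_indic// setIT /= lebesgue_measure_itv/= lte_fin gtrDl x0.
  rewrite -EFinB opprD addrA subrr sub0r -EFinM mulVf ?oppr_eq0//; exact: ltr0_neq0.
- rewrite (_ : (fun t => _) = fun t => (x^-1 * \1_(`]theta, theta + x]) t)%:E); last first.
    apply/funext => t; congr EFin; rewrite /kern indicE mem_setE in_itv/=.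
    rewrite lerBlDl subr_gt0 subr_lt0 lerBrDl.
    have [tt|tt] := ltP t theta.
      by rewrite (ltNge theta) (ltW tt)/= andbT leNgt (lt_trans tt) ?ltrDl//= subr0.
    by rewrite andbF subr0.
  under eq_integral do rewrite EFinM.
  rewrite ge0_integralZl//; last 2 first.
  - by apply/measurable_EFinP/measurable_indic.
  - by rewrite lee_fin invr_ge0 ltW.
  rewrite integral_indic// setIT /= lebesgue_measure_itv/= lte_fin ltrDl x0.
  rewrite -EFinB addrAC subrr add0r -EFinM mulVf//; exact: lt0r_neq0.
- by under eq_integral do rewrite /kern invr0 mul0r; rewrite integral0.
Qed.

End Kern.

(** * Conditionally independent variables *)

Section KernelFunctional.
Local Open Scope ereal_scope.
Context d (Omega : measurableType d) (R : realType) (P : probability Omega R)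
  dT (T : measurableType dT).
Variable kap : Omega -> {measure set T -> \bar R}.
Hypothesis mkap : forall U, measurable U -> measurable_fun setT (fun w => kap w U).
Hypothesis kap1 : forall w, kap w setT <= 1.

Lemma measurable_kernel_integral (f : T -> \bar R) :
  measurable_fun setT f -> (forall x, 0 <= f x) ->
  measurable_fun setT (fun w => \int[kap w]_x f x).
Proof. by move=> mf f0; exact: measurable_fun_integral_kernel. Qed.

Lemma kernel_integral_le1 w (f : T -> \bar R) :
  measurable_fun setT f -> (forall x, 0 <= f x <= 1) -> 0 <= \int[kap w]_x f x <= 1.
Proof.
move=> mf f01; have f0 x : 0 <= f x by have /andP[] := f01 x.
rewrite integral_ge0//=; apply: le_trans (kap1 w).
have -> : kap w setT = \int[kap w]_x (cst 1) x by rewrite integral_cst// mul1e.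
by apply: ge0_le_integral => // x _; have /andP[] := f01 x.
Qed.

(** Two measures on [T], written through a random variable and through a random
    measure respectively, have the same integrals if they agree on sets. *)
Lemma eq_kernel_integral (Y : Omega -> T) (c c' : Omega -> \bar R) :
  measurable_fun setT Y -> measurable_fun setT c -> measurable_fun setT c' ->
  (forall w, 0 <= c w <= 1) -> (forall w, 0 <= c' w <= 1) ->
  (forall A, measurable A ->
     \int[P]_w ((\1_A (Y w))%:E * c w) = \int[P]_w (kap w A * c' w)) ->
  forall f : T -> \bar R, measurable_fun setT f -> (forall x, 0 <= f x) ->
  \int[P]_w (f (Y w) * c w) = \int[P]_w ((\int[kap w]_x f x) * c' w).
Proof.
move=> mY mc mc' c01 c'01 YA.
have c0 w : 0 <= c w by have /andP[] := c01 w.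
have c'0 w : 0 <= c' w by have /andP[] := c'01 w.
have cfin w : c w \is a fin_num.
  by have /andP[? ?] := c01 w; rewrite ge0_fin_numE// (le_lt_trans (y := 1))// ltry.
have c'fin w : c' w \is a fin_num.
  by have /andP[? ?] := c'01 w; rewrite ge0_fin_numE// (le_lt_trans (y := 1))// ltry.
have mfY (f : T -> \bar R) : measurable_fun setT f -> measurable_fun setT (fun w => f (Y w)).
  by move=> mf; exact: measurableT_comp.
apply: ge0_measurable_fun_ind => [A mA|k f k0 mf f0 fE|f g mf mg f0 g0 fE gE|f_ mf_ f_0 ndf_ f_E].
- rewrite YA//; apply: eq_integral => w _; congr (_ * _).
  by rewrite integral_indic// setIT.
- under eq_integral do rewrite -muleA.
  rewrite [LHS]ge0_integralZl; last 4 first.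
  + exact: measurableT.
  + by apply: emeasurable_funM => //; exact: mfY.
  + by move=> w _; rewrite mule_ge0.
  + by rewrite lee_fin.
  under [RHS]eq_integral do rewrite ge0_integralZl// -muleA.
  rewrite [RHS]ge0_integralZl//; last 2 first.
  + by apply: emeasurable_funM => //; exact: measurable_kernel_integral.
  + by move=> w _; rewrite mule_ge0// integral_ge0.
  by rewrite fE.
- under eq_integral do rewrite /= ge0_muleDl//.
  rewrite [LHS]ge0_integralD; last 5 first.
  + exact: measurableT.
  + by move=> w _; rewrite mule_ge0.
  + by apply: emeasurable_funM => //; exact: mfY.
  + by move=> w _; rewrite mule_ge0.
  + by apply: emeasurable_funM => //; exact: mfY.
  under [RHS]eq_integral do rewrite /= ge0_integralD// ge0_muleDl ?integral_ge0//.
  rewrite [RHS]ge0_integralD//; last 4 first.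
  + by move=> w _; rewrite mule_ge0// integral_ge0.
  + by apply: emeasurable_funM => //; exact: measurable_kernel_integral.
  + by move=> w _; rewrite mule_ge0// integral_ge0.
  + by apply: emeasurable_funM => //; exact: measurable_kernel_integral.
  by rewrite fE gE.
- transitivity (\int[P]_w limn (fun n => f_ n (Y w) * c w)).
    apply: eq_integral => w _; rewrite limeMr//.
    exact/ereal_nondecreasing_is_cvgn/ndf_.
  rewrite monotone_convergence//; last 3 first.
  + by move=> n; apply: emeasurable_funM => //; exact: mfY.
  + by move=> n w _; rewrite mule_ge0.
  + by move=> w _ m n mn; rewrite lee_wpmul2r//; exact: ndf_.
  transitivity (\int[P]_w limn (fun n => (\int[kap w]_x f_ n x) * c' w)); last first.
    apply: eq_integral => w _; rewrite limeMr//.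
      by congr (_ * _); rewrite monotone_convergence// => x _; exact: ndf_.
    apply: ereal_nondecreasing_is_cvgn => m n mn.
    by apply: ge0_le_integral => // x _; exact: ndf_.
  rewrite [RHS]monotone_convergence//; last 3 first.
  + by move=> n; apply: emeasurable_funM => //; exact: measurable_kernel_integral.
  + by move=> n w _; rewrite mule_ge0// integral_ge0.
  + move=> w _ m n mn; rewrite lee_wpmul2r//.
    by apply: ge0_le_integral => // x _; exact: ndf_.
  by congr (limn _); apply/funext => n; exact: f_E.
Qed.

Variables (N : nat) (X : 'I_N -> Omega -> T).
Hypothesis mX : forall k, measurable_fun setT (X k).
Hypothesis XA : forall A : 'I_N -> set T, (forall k, measurable (A k)) ->
  \int[P]_w \prod_(k < N) (\1_(A k) (X k w))%:E =
  \int[P]_w \prod_(k < N) kap w (A k).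

(** The hypothesis [XA], conditional independence tested on indicators, extends
    to functions one coordinate after the other: with the other factors frozen,
    both sides are integrals of the function of the current coordinate. *)
Lemma cond_independent_prod (f : 'I_N -> T -> \bar R) :
  (forall k, measurable_fun setT (f k)) -> (forall k x, 0 <= f k x <= 1) ->
  \int[P]_w \prod_(k < N) f k (X k w) =
  \int[P]_w \prod_(k < N) \int[kap w]_x f k x.
Proof.
(* the functions at coordinates from [j] on are still indicators *)
suff H (j : nat) : forall f : 'I_N -> T -> \bar R,
  (forall k, measurable_fun setT (f k)) -> (forall k x, 0 <= f k x <= 1) ->
  (forall k : 'I_N, (j <= k)%N -> exists2 A, measurable A & f k = EFin \o \1_A) ->
  \int[P]_w \prod_(k < N) f k (X k w) =
  \int[P]_w \prod_(k < N) \int[kap w]_x f k x.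
  by move=> mf f01; apply: (H N) => // k; rewrite leqNgt ltn_ord.
elim: j => [|j ih] {}f mf f01 fA.
  have /choice[A A_f] : forall k, exists A, measurable A /\ f k = EFin \o \1_A.
    by move=> k; have [A mA fk] := fA k (leq0n _); exists A.
  under eq_integral do under eq_bigr do rewrite (proj2 (A_f _)).
  rewrite XA; last by move=> k; have [] := A_f k.
  apply: eq_integral => w _; apply: eq_bigr => k _.
  by have [mA ->] := A_f k; rewrite integral_indic// setIT.
have [jN|Nj] := ltnP j N; last first.
  apply: ih => // k jk; apply: fA; rewrite ltn_neqAle jk andbT.
  by apply: contraTneq (ltn_ord k) => <-; rewrite -leqNgt.
pose i0 := Ordinal jN.
have f0 k x : 0 <= f k x by have /andP[] := f01 k x.
under eq_integral do rewrite (bigD1 i0)//=.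
under [RHS]eq_integral do rewrite (bigD1 i0)//=.
apply: eq_kernel_integral => //.
- by apply: emeasurable_prod => k; exact: measurableT_comp.
- by apply: emeasurable_prod => k; exact: measurable_kernel_integral.
- by move=> w; exact: prode_itv01.
- by move=> w; apply: prode_itv01 => k; exact: kernel_integral_le1.
move=> A mA.
pose g k := if k == i0 then EFin \o \1_A else f k.
have := ih g; rewrite /g => /(_ _ _ _)/wrap[].
- by move=> k; case: ifP => // _; exact/measurable_EFinP/measurable_indic.
- move=> k x; case: ifP => // _ /=.
  by rewrite indicE; case: (x \in A); rewrite ?lee01 ?lexx.
- move=> k jk; case: ifPn => [_|ki]; first by exists A.
  by apply: fA; rewrite ltn_neqAle jk andbT eq_sym.
under eq_integral do rewrite (bigD1 i0)//= eqxx.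
under [in X in _ = X -> _]eq_integral do rewrite (bigD1 i0)//= eqxx integral_indic// setIT.
move=> E; transitivity (\int[P]_w ((\1_A (X i0 w))%:E *
    \prod_(k | k != i0) (if k == i0 then EFin \o \1_A else f k) (X k w))).
  by apply: eq_integral => w _; congr (_ * _); apply: eq_bigr => k /negbTE ->.
rewrite E; apply: eq_integral => w _; congr (_ * _).
by apply: eq_bigr => k /negbTE ->.
Qed.

End KernelFunctional.

(** * Integrating out the random law *)

Lemma fine_inj_01 (R : realType) (x y : \bar R) :
  (0 <= x <= 1)%E -> (0 <= y <= 1)%E -> fine x = fine y -> x = y.
Proof.
move=> /andP[x0 x1] /andP[y0 y1] xy.
rewrite -[x]fineK ?ge0_fin_numE ?(le_lt_trans x1) ?ltry//.
by rewrite -[y]fineK ?ge0_fin_numE ?(le_lt_trans y1) ?ltry// xy.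
Qed.

Section SpeciesMeasurable.
Local Open Scope ereal_scope.
Context (R : realType) (d : measure_display) (Omega : measurableType d)
  (P : probability Omega R) (H : probability (measurableTypeR R) R) (K : pred nat)
  (W xi : nat -> {RV P >-> measurableTypeR R})
  (G : Omega -> probability (measurableTypeR R) R).

Lemma species_measurable : species_sampling H K W xi G ->
  forall U, measurable U -> measurable_fun setT (fun w => G w U).
Proof.
move=> [_ W01 _ _ _ form] U mU.
rewrite (_ : (fun w => _) = fun w =>
    (\sum_(k <oo | K k) (W k w)%:E * \d_(xi k w : measurableTypeR R) U
             + (1 - \sum_(k <oo | K k) (W k w)%:E) * H U)); last first.
  by apply/funext => w; exact: form.
have mW k : measurable_fun setT (fun w => (W k w)%:E).
  by apply/measurable_EFinP; exact: (@measurable_funPT _ _ _ _ (W k)).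
apply: emeasurable_funD.
  apply: (ge0_emeasurable_sum (P := K)) => [k w _ Kk|k Kk].
    by rewrite mule_ge0// lee_fin; have /andP[/ltW] := W01 k w Kk.
  apply: emeasurable_funM => //.
  rewrite (_ : (fun w => _) = fun w => (\1_U (xi k w))%:E)//.
  apply/measurable_EFinP; apply: (measurableT_comp (f := \1_U : _ -> R)).
    exact: measurable_indic.
  exact: (@measurable_funPT _ _ _ _ (xi k)).
apply: emeasurable_funM => //; apply: emeasurable_funB => //.
by apply: (ge0_emeasurable_sum (P := K)) => // k w _ Kk; rewrite lee_fin;
  have /andP[/ltW] := W01 k w Kk.
Qed.

End SpeciesMeasurable.

Section LatentLaw.
Local Open Scope ereal_scope.
Context (R : realType) (d : measure_display) (Omega : measurableType d)
  (P : probability Omega R) (G : Omega -> probability (measurableTypeR R) R)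
  (theta : R) (N : nat) (X T : 'I_N -> {RV P >-> measurableTypeR R}).
Local Notation S := (measurableTypeR R).
Hypothesis mG : forall U, measurable U -> measurable_fun setT (fun w => G w U).
Hypothesis hXT : latent_model theta G X T.

Definition kern_mass (B : set S) (x : S) : \bar R :=
  \int[@lebesgue_measure R]_t ((\1_B t)%:E * (kern theta x t)%:E).

Let mkern_joint (B : set S) : measurable B -> measurable_fun [set: S * S]
  (fun z => (\1_B z.2)%:E * (kern theta z.1 z.2)%:E).
Proof.
move=> mB; apply: emeasurable_funM; apply/measurable_EFinP.
  apply: (measurableT_comp (f := \1_B : S -> R)) => //.
by apply: measurable_kern2.
Qed.

Lemma measurable_kern_mass B : measurable B -> measurable_fun setT (kern_mass B).
Proof.
move=> mB; apply: (@measurable_fun_fubini_tonelli_F _ _ S S R (@lebesgue_measure R)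
   (fun z => (\1_B z.2)%:E * (kern theta z.1 z.2)%:E)); first exact: mkern_joint.
by move=> z; rewrite mule_ge0// lee_fin// kern_ge0.
Qed.

Lemma kern_mass_ge0 B x : 0 <= kern_mass B x.
Proof. by apply: integral_ge0 => t _; rewrite mule_ge0// lee_fin// kern_ge0. Qed.

Let mkern x : measurable_fun [set: S] (fun t => (kern theta x t)%:E).
Proof. by apply/measurable_EFinP; apply: measurable_kern2. Qed.

Lemma kern_mass_le B x : measurable B -> kern_mass B x <= (x != 0%R)%:R%:E.
Proof.
move=> mB; rewrite -(integral_kern theta x); apply: ge0_le_integral => //.
- by move=> t _; rewrite mule_ge0// lee_fin// kern_ge0.
- apply: emeasurable_funM => //; apply/measurable_EFinP.
  exact: measurable_indic.
- move=> t _; rewrite indicE; case: (t \in B); rewrite ?mul1e ?mul0e//.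
  by rewrite lee_fin kern_ge0.
Qed.

Lemma kern_massT x : kern_mass setT x = (x != 0%R)%:R%:E.
Proof.
rewrite -(integral_kern theta x); apply: eq_integral => t _.
by rewrite indicT mul1e.
Qed.

Lemma kern_massE B x : kern_mass B x = \int[@lebesgue_measure R]_(t in B) (kern theta x t)%:E.
Proof.
rewrite integral_mkcond; apply: eq_integral => t _.
by rewrite patchE indicE; case: ifP => tB; rewrite ?mul1e ?mul0e.
Qed.

Let nz (x : S) : \bar R := ((x : R) != 0%R)%:R%:E.
Let mnz : measurable_fun setT nz.
Proof.
rewrite (_ : nz = kern_mass setT); first exact: measurable_kern_mass.
by apply/funext => x; rewrite kern_massT.
Qed.
Let nz_ge0 x : 0 <= nz x. Proof. by rewrite lee_fin. Qed.

(* the law [G w] restricted to nonzero latent values, which are the only ones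
   compatible with an observation *)
Let kap w : {measure set S -> \bar R} := density_measure (G w) mnz nz_ge0.

Let mkap U : measurable U -> measurable_fun setT (fun w => kap w U).
Proof.
move=> mU; rewrite (_ : (fun w => _) = fun w => \int[G w]_x ((\1_U x)%:E * nz x)).
  apply: measurable_fun_integral_kernel => //.
    by move=> x; rewrite mule_ge0// lee_fin.
  by apply: emeasurable_funM => //; apply/measurable_EFinP; exact: measurable_indic.
by apply/funext => w; exact: density_measureE.
Qed.

Let kap1 w : kap w setT <= 1.
Proof.
rewrite /kap [X in X <= _]density_measureE// -(probability_setT (G w)).
rewrite -[leRHS]mul1e -integral_cst//; apply: ge0_le_integral => //.
- by move=> x _; rewrite mule_ge0// lee_fin.
- by apply: emeasurable_funM => //; apply/measurable_EFinP; exact: measurable_indic.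
- by move=> x _; rewrite indicT mul1e lee_fin lern1 leq_b1.
Qed.

Definition latent_fun (A B : set S) (x : S) : \bar R := (\1_A x)%:E * kern_mass B x.

Let mlatent_fun A B : measurable A -> measurable B -> measurable_fun setT (latent_fun A B).
Proof.
move=> mA mB; apply: emeasurable_funM; last exact: measurable_kern_mass.
by apply/measurable_EFinP; exact: measurable_indic.
Qed.

Let latent_fun01 A B x : measurable B -> 0 <= latent_fun A B x <= 1.
Proof.
move=> mB; rewrite mule_ge0 ?kern_mass_ge0 ?lee_fin//=.
rewrite /latent_fun indicE; case: (x \in A); rewrite ?mul0e// mul1e.
by rewrite (le_trans (kern_mass_le _ mB))// lee_fin lern1 leq_b1.
Qed.

Let integral01 (f : Omega -> \bar R) : measurable_fun setT f ->
  (forall w, 0 <= f w <= 1) -> 0 <= \int[P]_w f w <= 1.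
Proof.
move=> mf f01; have f0 w : 0 <= f w by have /andP[] := f01 w.
rewrite integral_ge0//= -(probability_setT P) -[leRHS]mul1e -integral_cst//.
by apply: ge0_le_integral => // w _; have /andP[] := f01 w.
Qed.

Let mXT A B : (forall k, measurable (A k)) -> (forall k, measurable (B k)) ->
  measurable [set w | forall k, A k (X k w) /\ B k (T k w)].
Proof.
move=> mA mB.
rewrite (_ : mkset _ = [set w | forall k, A k (X k w)] `&` [set w | forall k, B k (T k w)]).
  by apply: measurableI; apply: measurable_rectangle.
apply/seteqP; split => w /=; first by move=> h; split => k; have [] := h k.
by move=> [h1 h2] k.
Qed.

Let latent_law_kernel A B : (forall k, measurable (A k)) -> (forall k, measurable (B k)) ->
  P [set w | forall k, A k (X k w) /\ B k (T k w)] =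
  \int[P]_w \prod_(k < N) \int[kap w]_x latent_fun (A k) (B k) x.
Proof.
move=> mA mB; apply: fine_inj_01.
- by rewrite measure_ge0 probability_le1//; exact: mXT.
- apply: integral01.
    apply: emeasurable_prod => k; apply: measurable_kernel_integral => //; last 2 first.
      exact: mlatent_fun.
    by move=> x; have /andP[] := latent_fun01 (A k) x (mB k).
  move=> w; apply: prode_itv01 => k; apply: kernel_integral_le1 => //.
    exact: mlatent_fun.
  by move=> x; exact: latent_fun01.
have setTG : sigma_of G setT.
  by rewrite -setC0 -setTD; apply: sigma_algebraCD; exact: sigma_algebra0.
have := hXT setTG mA mB; rewrite setTI => ->.
rewrite /Rintegral; congr fine; apply: eq_integral => w _; rewrite -prodEFin.
apply: eq_bigr => k _; rewrite -[RHS]fineK; last first.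
  have /andP[g0 g1] : 0 <= \int[kap w]_x latent_fun (A k) (B k) x <= 1.
    apply: kernel_integral_le1 => //; first exact: mlatent_fun.
    by move=> x; exact: latent_fun01.
  by rewrite ge0_fin_numE// (le_lt_trans g1)// ltry.
congr (fine _)%:E; rewrite integral_density_measure//; last 2 first.
- exact: mlatent_fun.
- by move=> x; have /andP[] := latent_fun01 (A k) x (mB k).
rewrite [LHS]integral_mkcond; apply: eq_integral => x _.
rewrite patchE /latent_fun indicE; case: ifP => xA; rewrite ?mul0e// mul1e kern_massE.
have [x0|x0] := eqVneq (x : R) 0%R; last by rewrite /nz x0 mule1.
rewrite /nz x0 eqxx mule0; under eq_integral do rewrite /kern invr0 mul0r.
by rewrite integral0.
Qed.

(** The random law [G] is integrated out: the joint law of the latent values and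
    the observations is the law of the latent values with the kernel applied in
    each coordinate. With [B k = setT] the model gives conditional independence
    of the latent values on rectangles, which extends to functions. *)
Lemma latent_law A B : (forall k, measurable (A k)) -> (forall k, measurable (B k)) ->
  P [set w | forall k, A k (X k w) /\ B k (T k w)] =
  \int[P]_w \prod_(k < N) latent_fun (A k) (B k) (X k w).
Proof.
move=> mA mB; rewrite latent_law_kernel//.
apply/esym/cond_independent_prod => //.
- move=> {mA mB}A mA; have := latent_law_kernel mA (fun _ : 'I_N => @measurableT _ S).
  rewrite (_ : mkset _ = [set w | forall k, A k (X k w)]); last first.
    by apply/seteqP; split => w /= h k //; have [] := h k.
  move=> E; transitivity (P [set w | forall k, A k (X k w)]).
    rewrite -[X in P X]setIT -integral_indic//.
      apply: eq_integral => w _; rewrite prodEFin; congr EFin; rewrite indicE.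
      apply: prod_indic; apply: (iffP idP) => [|h]; rewrite inE.
        by move=> h k _; exact: h.
      by move=> k; exact: h.
    have := mXT mA (fun _ : 'I_N => @measurableT _ S); congr measurable.
    by apply/seteqP; split => w /= h k //; have [] := h k.
  rewrite E; apply: eq_integral => w _; apply: eq_bigr => k _.
  rewrite [RHS]density_measureE// integral_density_measure//; last 2 first.
  - exact: mlatent_fun.
  - by move=> x; have /andP[] := latent_fun01 (A k) x (@measurableT _ S).
  apply: eq_integral => x _; rewrite /latent_fun kern_massT -/(nz x) -muleA; congr (_ * _).
  by rewrite /nz; case: (_ != _); rewrite ?mule0 ?mule1.
- by move=> k; exact: mlatent_fun.
- by move=> k x; exact: latent_fun01.
Qed.

End LatentLaw.

(** * Bayes' formula *)

Section BayesVersion.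
Local Open Scope ereal_scope.
Context (R : realType) (d : measure_display) (Omega : measurableType d)
  (P : probability Omega R) (G : Omega -> probability (measurableTypeR R) R)
  (theta : R) (N : nat) (X T : 'I_N -> {RV P >-> measurableTypeR R}).
Local Notation S := (measurableTypeR R).
Hypothesis mG : forall U, measurable U -> measurable_fun setT (fun w => G w U).
Hypothesis hXT : latent_model theta G X T.
Let leb : {sigma_finite_measure set S -> \bar R} := @lebesgue_measure R.
Let lebN := product_measure leb N.

Definition box_bayes_num (A : 'I_N -> set S) (u : N.-tuple S) : \bar R :=
  \int[P]_w \prod_(k < N) ((\1_(A k) (X k w))%:E * (kern theta (X k w) (tnth u k))%:E).

Lemma likelihood_ge0 (x t : 'I_N -> R) : (0 <= likelihood theta x t)%R.
Proof. by apply: prodr_ge0 => k _; exact: kern_ge0. Qed.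

Lemma bayes_num_ge0 t D : 0 <= bayes_num theta X t D.
Proof. by apply: integral_ge0 => w _; rewrite lee_fin likelihood_ge0. Qed.

Lemma measurable_likelihood (t : 'I_N -> R) :
  measurable_fun setT (fun w => likelihood theta (fun k => X k w) t).
Proof.
apply: measurable_prod => k _; apply: measurable_kern2 => //.
exact: (@measurable_funPT _ _ _ _ (X k)).
Qed.

Lemma marginal_densityE t : marginal_density theta X t =
  \int[P]_w (likelihood theta (fun k => X k w) t)%:E.
Proof.
rewrite /marginal_density /bayes_num.
by congr integral.
Qed.

Lemma bayes_num_le t D : measurable [set w | D (fun k => X k w)] ->
  bayes_num theta X t D <= marginal_density theta X t.
Proof.
move=> mD; rewrite marginal_densityE; apply: ge0_subset_integral => //.
- by apply/measurable_EFinP; exact: measurable_likelihood.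
- by move=> w _; rewrite lee_fin likelihood_ge0.
Qed.

(** The density of an observation at [t] is at most [1 / |t - theta|], whatever
    the latent value. *)
Lemma marginal_density_lty t : marginal_density theta X t < +oo.
Proof.
rewrite marginal_densityE; apply: (@le_lt_trans _ _ (\prod_(k < N) `|t k - theta|^-1)%R%:E);
  last exact: ltry.
have -> : (\prod_(k < N) `|t k - theta|^-1)%R%:E =
    \int[P]_w (cst (\prod_(k < N) `|t k - theta|^-1)%R%:E) w.
  by rewrite integral_cst// -[LHS]mule1; congr (_ * _); exact/esym/probability_setT.
apply: ge0_le_integral => //.
- by move=> w _; rewrite lee_fin likelihood_ge0.
- by apply/measurable_EFinP; exact: measurable_likelihood.
- move=> w _; rewrite lee_fin; apply: ler_prod => k _.
  by rewrite kern_ge0 kern_le.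
Qed.

Lemma box_bayes_numE A (u : N.-tuple S) :
  bayes_num theta X (tnth u) [set x | forall k, A k (x k)] = box_bayes_num A u.
Proof.
rewrite /bayes_num integral_mkcond; apply: eq_integral => w _.
under eq_bigr do rewrite -EFinM.
rewrite prodEFin big_split/= patchE
  (@prod_indic _ _ _ _ _ _ (w \in [set w | forall k, A k (X k w)])).
  by case: ifP; rewrite ?mul1r ?mul0r.
by apply: (iffP idP) => [|h]; rewrite inE; [move=> h k _; exact: h|move=> k; exact: h].
Qed.

Let box_integrand A (z : Omega * N.-tuple S) : \bar R :=
  \prod_(k < N) ((\1_(A k) (X k z.1))%:E * (kern theta (X k z.1) (tnth z.2 k))%:E).

Let box_integrand_ge0 A z : 0 <= box_integrand A z.
Proof. by apply: prode_ge0 => k _; rewrite mule_ge0// lee_fin// kern_ge0. Qed.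

Let measurable_box_integrand A : (forall k, measurable (A k)) ->
  measurable_fun setT (box_integrand A).
Proof.
move=> mA; apply: emeasurable_prod => k.
have mXk : measurable_fun setT (fun z : Omega * N.-tuple S => X k z.1).
  by apply: measurableT_comp => //.
apply: emeasurable_funM; apply/measurable_EFinP.
  by apply: (measurableT_comp (f := \1_(A k) : S -> R)).
apply: measurable_kern2 => //.
apply: (measurableT_comp (f := (@tnth _ S)^~ k)) => //; exact: measurable_tnth.
Qed.

Lemma measurable_box_bayes_num A : (forall k, measurable (A k)) ->
  measurable_fun setT (box_bayes_num A).
Proof.
move=> mA; apply: (@measurable_fun_fubini_tonelli_G _ _ _ _ R P (box_integrand A)) => //.
exact: measurable_box_integrand.
Qed.

Lemma box_bayes_num_ge0 A u : 0 <= box_bayes_num A u.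
Proof. by rewrite -box_bayes_numE bayes_num_ge0. Qed.

(** The product of the [N] integrals over the observations is an integral over
    [N]-tuples, and Tonelli's theorem exchanges it with the expectation. *)
Lemma joint_density A B : (forall k, measurable (A k)) -> (forall k, measurable (B k)) ->
  P [set w | forall k, A k (X k w) /\ B k (T k w)] =
  \int[lebN]_u ((\1_(tuple_box B) u)%:E * box_bayes_num A u).
Proof.
move=> mA mB; rewrite (latent_law mG hXT)//.
have mbox := measurable_tuple_box mB.
transitivity (\int[P]_w \int[lebN]_u ((\1_(tuple_box B) u)%:E * box_integrand A (w, u))).
  apply: eq_integral => w _.
  transitivity (\prod_(k < N) \int[leb]_t ((\1_(A k) (X k w))%:E *
       ((\1_(B k) t)%:E * (kern theta (X k w) t)%:E))).
    apply: eq_bigr => k _; rewrite [RHS]ge0_integralZl//.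
    - apply: emeasurable_funM; apply/measurable_EFinP => //.
      by apply: measurable_kern2.
    - by move=> t _; rewrite mule_ge0// lee_fin// kern_ge0.
  rewrite -(integral_product_measure leb
     (f := fun k t => (\1_(A k) (X k w))%:E * ((\1_(B k) t)%:E * (kern theta (X k w) t)%:E))).
  - apply: eq_integral => u _; rewrite /box_integrand.
    under eq_bigr do rewrite muleCA.
    rewrite big_split/=; congr (_ * _); rewrite prodEFin; congr EFin.
    rewrite indicE; apply: prod_indic.
    by apply: (iffP idP) => [|h]; rewrite inE; [move=> h k _; exact: h|move=> k; exact: h].
  - move=> k; apply: emeasurable_funM => //; apply: emeasurable_funM; apply/measurable_EFinP => //.
    by apply: measurable_kern2.
  - by move=> k t; rewrite !mule_ge0// lee_fin// kern_ge0.
rewrite (fubini_tonelli (m1 := P) (m2 := lebN)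
  (fun z => (\1_(tuple_box B) z.2)%:E * box_integrand A z)); last 2 first.
- apply: emeasurable_funM; last exact: measurable_box_integrand.
  apply/measurable_EFinP.
  by apply: (measurableT_comp (f := \1_(tuple_box B) : N.-tuple S -> R)).
- by move=> z; rewrite mule_ge0// lee_fin.
apply: eq_integral => u _; rewrite /= ge0_integralZl//.
  apply: (@measurable_fun_pair1 _ _ _ _ _ _ (box_integrand A) u).
  exact: measurable_box_integrand.
Qed.

Let m (u : N.-tuple S) := marginal_density theta X (tnth u).

Let mE u : m u = box_bayes_num (fun=> setT) u.
Proof.
rewrite -box_bayes_numE /m /marginal_density; congr (bayes_num _ _ _ _).
by apply/seteqP; split.
Qed.

Let mm : measurable_fun setT m.
Proof.
rewrite (_ : m = box_bayes_num (fun=> setT)); first exact: measurable_box_bayes_num.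
by apply/funext => u; exact: mE.
Qed.

Let m0 u : 0 <= m u. Proof. exact: bayes_num_ge0. Qed.

Let mfin u : m u \is a fin_num.
Proof. by rewrite ge0_fin_numE// marginal_density_lty. Qed.

Lemma observation_density (h : N.-tuple S -> \bar R) :
  measurable_fun setT h -> (forall u, 0 <= h u) ->
  \int[P]_w h (sample T w) = \int[lebN]_u (h u * m u).
Proof.
move=> mh h0; rewrite -(integral_image_measure (measurable_sample T))//.
rewrite -(integral_density_measure lebN mm m0)//.
apply: eq_measure_integral => D mD _; apply: tuple_measure_unique => // [|B mB].
  by rewrite -[X in X < _]/(P setT) probability_setT ltry.
rewrite [RHS]density_measureE//; last exact: measurable_tuple_box.
under eq_integral do rewrite mE.
rewrite -joint_density// /image_measure /pushforward; congr (P _).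
apply/seteqP; split => w /= h' k; have := h' k; rewrite tnth_mktuple//.
by case.
Qed.

(** Bayes' formula: the posterior times the density of the observations is the
    joint density; where the latter density vanishes, so does the numerator. *)
Lemma bayes_version A B : (forall k, measurable (A k)) -> (forall k, measurable (B k)) ->
  fine (P [set w | forall k, A k (X k w) /\ B k (T k w)])
    = (\int[P]_(w in [set w | forall k, B k (T k w)])
         posterior theta X (fun k => T k w)
           [set x | forall k, A k (x k)])%R.
Proof.
move=> mA mB; rewrite joint_density// /Rintegral; congr fine.
rewrite [RHS]integral_mkcond.
pose post u := (fine (box_bayes_num A u) / fine (m u))%R.
have mpost : measurable_fun setT post.
  apply: measurable_funM.
    by apply: (measurableT_comp (f := fine)) => //; exact: measurable_box_bayes_num.
  apply: measurable_inv.
  by apply: (measurableT_comp (f := fine)).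
have post0 u : (0 <= post u)%R.
  by rewrite divr_ge0// fine_ge0// box_bayes_num_ge0.
have mbox := measurable_tuple_box mB.
pose h u := (\1_(tuple_box B) u)%:E * (post u)%:E.
transitivity (\int[P]_w h (sample T w)).
  rewrite observation_density; last 2 first.
  - by apply: emeasurable_funM; apply/measurable_EFinP.
  - by move=> u; rewrite mule_ge0// lee_fin.
  apply: eq_integral => u _; rewrite /h -muleA; congr (_ * _).
  have bm : box_bayes_num A u <= m u.
    rewrite -box_bayes_numE; apply: bayes_num_le.
    exact: measurable_rectangle.
  have b0 := box_bayes_num_ge0 A u.
  have bfin : box_bayes_num A u \is a fin_num.
    by rewrite ge0_fin_numE// (le_lt_trans bm)// marginal_density_lty.
  rewrite -[in RHS](fineK (mfin u)) -EFinM -[LHS]fineK//; congr EFin.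
  have [fm0|fm0] := eqVneq (fine (m u)) 0%R; last by rewrite divfK.
  rewrite fm0 mulr0; apply/eqP; rewrite eq_le fine_ge0// andbT -fm0.
  exact: fine_le.
apply: eq_integral => w _; rewrite patchE /h /=.
have post_w : post (sample T w) = posterior theta X (fun k => T k w) [set x | forall k, A k (x k)].
  have tw : tnth (sample T w) = fun k => T k w by apply/funext => k; rewrite tnth_mktuple.
  by rewrite /post -box_bayes_numE /m tw.
rewrite post_w indicE.
have -> : (sample T w \in tuple_box B) = (w \in [set w | forall k, B k (T k w)]).
  by apply/idP/idP; rewrite !inE => hk k; have := hk k; rewrite tnth_mktuple.
by case: ifP => _; rewrite ?mul1e ?mul0e.
Qed.

End BayesVersion.

(** * The path of a partition *)

Section KernelPartitions.
Variables (I : finType).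
Implicit Types (p : {set {set I}}).
Local Notation preim h := (preim_partition h [set: I]%SET).

Lemma preim_partitionT (E : eqType) (h : I -> E) :
  finset.partition (preim h) [set: I]%SET.
Proof. exact: preim_partitionP. Qed.

Lemma eq_equivalence_partition (e e' : rel I) : (forall x y, e x y = e' x y) ->
  finset.equivalence_partition e [set: I]%SET =
  finset.equivalence_partition e' [set: I]%SET.
Proof. by move=> ee'; apply: eq_imset => x; apply/setP => y; rewrite !inE ee'. Qed.

Lemma eq_preim_partition (E E' : eqType) (h : I -> E) (h' : I -> E') :
  (forall x y, (h x == h y) = (h' x == h' y)) -> preim h = preim h'.
Proof.
by move=> hh'; exact: eq_equivalence_partition.
Qed.

Lemma mem_pblock_preim (E : eqType) (h : I -> E) x y :
  (y \in finset.pblock (preim h) x) = (h x == h y).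
Proof.
rewrite pblock_equivalence_partition ?inE//.
by split=> // /eqP ->.
Qed.

Lemma eq_pblock_preim (E : eqType) (h : I -> E) x y :
  (finset.pblock (preim h) x == finset.pblock (preim h) y) = (h x == h y).
Proof. by rewrite (eq_pblockT (preim_partitionT h)) mem_pblock_preim. Qed.

End KernelPartitions.

Section PathOfPartition.
Variable n : nat.
Implicit Types (p : {set {set 'I_n}}) (S : spath n).

Lemma spath0 S : S ord0 = 0%N :> nat.
Proof. by case: S => S /= /and4P[/eqP]. Qed.

Lemma spath_mono S (j : 'I_n) : (S (widen_ord (leqnSn n) j) <= S (lift ord0 j))%N.
Proof. by case: S => S /= /and4P[_ _ _ /forallP]. Qed.

Lemma spath_step S (j : 'I_n) :
  S (lift ord0 j) = (S (widen_ord (leqnSn n) j) + jump S j)%N :> nat.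
Proof. by rewrite /jump subnKC// spath_mono. Qed.

Lemma eq_spath S S' : (forall j, jump S j = jump S' j) -> S = S'.
Proof.
move=> SS'; apply/val_inj/ffunP => -[k kn]; apply/val_inj => /=.
elim: k kn => [|k ih] kn.
  by rewrite (_ : Ordinal kn = ord0) ?spath0//; exact/val_inj.
have kn' : (k < n)%N by [].
have -> : Ordinal kn = lift ord0 (Ordinal kn') by exact/val_inj.
rewrite !spath_step SS'; congr (_ + _)%N.
have -> : widen_ord (leqnSn n) (Ordinal kn') = Ordinal (ltnW kn) by exact/val_inj.
exact: ih.
Qed.

Lemma max_exists (C : {set 'I_n}) : C != finset.set0 -> exists j, is_max_of j C.
Proof.
move=> /set0Pn[i0 i0C]; case: (arg_maxnP (fun i : 'I_n => i : nat) i0C) => j jC jmax.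
by exists j; apply/andP; split; [exact: jC|apply/forall_inP => i iC; exact: jmax].
Qed.

Lemma max_unique (C : {set 'I_n}) i j : is_max_of i C -> is_max_of j C -> i = j.
Proof.
move=> /andP[iC /forall_inP imax] /andP[jC /forall_inP jmax].
by apply/val_inj/anti_leq; rewrite jmax// imax.
Qed.

(** The jump that a path must have at [j] to correspond to [p]: the size of the
    cell of which [j] is the maximum, and zero if there is none. *)
Definition max_block_size p (j : 'I_n) : nat :=
  #|[set i | is_max_of j (finset.pblock p i)]%SET|.

Lemma max_block_sizeE p C j : finset.partition p [set: 'I_n]%SET -> C \in p ->
  is_max_of j C -> max_block_size p j = #|C|.
Proof.
move=> pT Cp jC; congr #|pred_of_set _|; apply/setP => i; rewrite inE.
apply/idP/idP => [jmax|iC]; last by rewrite (pblockT_id pT Cp iC).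
have /andP[ji _] := jmax; have /andP[jinC _] := jC.
rewrite -(pblockT_id pT Cp jinC) (pblockT_id pT (pblockT_mem pT i) ji).
exact: mem_pblockT.
Qed.

Lemma corresponds_partition p S : corresponds p S -> finset.partition p [set: 'I_n]%SET.
Proof. by case/and3P. Qed.

Lemma corresponds_jump p S j : corresponds p S -> jump S j = max_block_size p j.
Proof.
case/and3P => pT /forallP/(_ j)/eqP jex /forall_inP jsize.
case: (posnP (jump S j)) jex => [-> /existsPn jex|jpos /existsP[C /andP[Cp Cj]]].
  apply/esym/eqP; rewrite cards_eq0; apply/eqP/setP => i; rewrite !inE.
  by have := jex (finset.pblock p i); rewrite pblockT_mem //= => /negbTE.
rewrite (max_block_sizeE pT Cp Cj).
by have /forallP/(_ j) := jsize C Cp; rewrite Cj => /eqP.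
Qed.

Lemma corresponds_unique p S S' : corresponds p S -> corresponds p S' -> S = S'.
Proof.
by move=> pS pS'; apply: eq_spath => j; rewrite (corresponds_jump _ pS) (corresponds_jump _ pS').
Qed.

(** The labels whose whole cell lies strictly below [k]; their number is the
    coordinate at [k] of the path of [p]. *)
Definition below p (k : nat) : {set 'I_n} :=
  [set i | [forall j in finset.pblock p i, (j < k)%N]]%SET.

Lemma below_step p (j : 'I_n) : finset.partition p [set: 'I_n]%SET ->
  #|below p j.+1| = (#|below p j| + max_block_size p j)%N.
Proof.
move=> pT; rewrite -(cardsID (below p j)); congr (_ + _)%N; congr #|pred_of_set _|.
  apply/finset.setIidPr/fintype.subsetP => i; rewrite !inE => /forall_inP h.
  by apply/forall_inP => k /h; exact: ltnW.
apply/setP => i; rewrite !inE; apply/andP/andP => [[/forall_inPn[k ki kj] /forall_inP h]|].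
  have /eqP kjE : (k : nat) == j by rewrite eqn_leq -ltnS h//= leqNgt.
  have <- : k = j by exact/val_inj.
  by split=> //; apply/forall_inP => l /h; rewrite ltnS kjE.
move=> [ji /forall_inP h]; split; last by apply/forall_inP => k /h.
by apply/forall_inPn; exists j => //; rewrite ltnn.
Qed.

(** [#|below p k| <= k] because [below p k] consists of labels below [k], and the
    increments count cells by their maxima. *)
Lemma path_exists p : finset.partition p [set: 'I_n]%SET -> exists S : spath n, corresponds p S.
Proof.
move=> pT.
have bn k : (#|below p k| < n.+1)%N.
  by rewrite ltnS -[X in (_ <= X)%N]card_ord max_card.
pose f := [ffun k : 'I_n.+1 => Ordinal (bn k)].
have fS : is_spath f.
  apply/and4P; split.
  - rewrite ffunE /= cards_eq0; apply/eqP/setP => i; rewrite !inE.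
    by apply/forall_inPn; exists i => //; exact: mem_pblockT.
  - rewrite ffunE /= (_ : below p n = [set: 'I_n]%SET) ?cardsT ?card_ord//.
    by apply/setP => i; rewrite !inE; apply/forall_inP.
  - apply/forallP => k; rewrite ffunE /=.
    have kn : (k <= n)%N by rewrite -ltnS.
    have : below p k \subset [set widen_ord kn i | i in [set: 'I_k]%SET]%SET.
      apply/fintype.subsetP => i; rewrite inE => /forall_inP/(_ i (mem_pblockT pT i)) ik.
      by apply/imsetP; exists (Ordinal ik); rewrite ?inE//; exact/val_inj.
    move=> /subset_leq_card /leq_trans; apply.
    by rewrite (leq_trans (leq_imset_card _ _))// cardsT card_ord.
  - by apply/forallP => j; rewrite !ffunE /= below_step// leq_addr.
have jE j : jump (SPath fS) j = max_block_size p j.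
  by rewrite /jump /= !ffunE /= below_step// addKn.
exists (SPath fS); apply/and3P; split=> //.
  apply/forallP => j; rewrite jE; apply/eqP; apply/idP/idP.
    move=> /existsP[C /andP[Cp jC]]; rewrite (max_block_sizeE pT Cp jC).
    by apply/card_gt0P; exists j; have /andP[] := jC.
  move=> /card_gt0P[i]; rewrite inE => ji; apply/existsP.
  by exists (finset.pblock p i); rewrite pblockT_mem.
apply/forall_inP => C Cp; apply/forallP => j; apply/implyP => jC.
by rewrite jE (max_block_sizeE pT Cp jC).
Qed.

Lemma corresponds_maxP p S j : corresponds p S ->
  (0 < jump S j)%N = is_max_of j (finset.pblock p j).
Proof.
move=> pS; have pT := corresponds_partition pS.
have /and3P[_ /forallP/(_ j)/eqP <- _] := pS.
apply/existsP/idP => [[C /andP[Cp jC]]|jmax].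
  by have /andP[jinC _] := jC; rewrite (pblockT_id pT Cp jinC).
by exists (finset.pblock p j); rewrite pblockT_mem.
Qed.

Lemma corresponds_card p S j : corresponds p S -> (0 < jump S j)%N ->
  #|finset.pblock p j| = jump S j.
Proof.
move=> pS; rewrite (corresponds_maxP _ pS) (corresponds_jump _ pS) => jmax.
have pT := corresponds_partition pS.
by rewrite (max_block_sizeE pT (pblockT_mem pT j) jmax).
Qed.

Lemma corresponds_transversal p S C : corresponds p S -> C \in p ->
  exists j, forall i, (i \in C) && (0 < jump S i)%N = (i == j).
Proof.
move=> pS Cp; have pT := corresponds_partition pS.
have [j jmax] : exists j, is_max_of j C.
  by apply: max_exists; apply: contraTneq Cp => ->; have /and3P[] := pT.
exists j => i; apply/andP/eqP => [[iC]|->].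
  by rewrite (corresponds_maxP _ pS) (pblockT_id pT Cp iC) => /max_unique; apply.
have /andP[jC _] := jmax.
by rewrite jC (corresponds_maxP _ pS) (pblockT_id pT Cp jC).
Qed.

End PathOfPartition.

(** * Gluing partitions of the two groups of labels *)

Section Glue.
Variables (I J K : finType) (f : I -> K) (g : J -> K).
Hypotheses (f_inj : injective f) (g_inj : injective g)
  (fg_disj : forall i j, f i != g j)
  (fg_cover : forall k, (exists i, k = f i) \/ (exists j, k = g j)).

Lemma big_images (A : Type) (idx : A) (op : Monoid.com_law idx) (s : pred K) (F : K -> A) :
  \big[op/idx]_(k | s k) F k =
  op (\big[op/idx]_(i | s (f i)) F (f i)) (\big[op/idx]_(j | s (g j)) F (g j)).
Proof.
pose h (x : I + J) := match x with inl i => f i | inr j => g j end.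
have h_bij : bijective h.
  apply: inj_card_bij.
    move=> [i|j] [i'|j'] /= E.
    - by rewrite (f_inj E).
    - by have := fg_disj i j'; rewrite E eqxx.
    - by have := fg_disj i' j; rewrite E eqxx.
    - by rewrite (g_inj E).
  rewrite -(card_codom (f := id)) //.
  have h_surj k : k \in codom h.
    by case: (fg_cover k) => [[i ->]|[j ->]];
      [exact: (codom_f h (inl i))|exact: (codom_f h (inr j))].
  apply: leq_trans (leq_image_card h _); apply: subset_leq_card.
  by apply/fintype.subsetP => k _; exact: h_surj.
rewrite (reindex h) /=; last exact: onW_bij.
by rewrite big_sumType.
Qed.

Definition glue_fun (E : Type) (e : E) (a : I -> E) (b : J -> E) (k : K) : E :=
  match [pick i | f i == k], [pick j | g j == k] with
  | Some i, _ => a i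
  | None, Some j => b j
  | None, None => e
  end.

Lemma glue_fun_f E (e : E) a b i : glue_fun e a b (f i) = a i.
Proof.
rewrite /glue_fun; case: pickP => [i' /eqP /f_inj -> //|/(_ i)].
by rewrite eqxx.
Qed.

Lemma glue_fun_g E (e : E) a b j : glue_fun e a b (g j) = b j.
Proof.
rewrite /glue_fun; case: pickP => [i' /eqP ii|_].
  by have := fg_disj i' j; rewrite ii eqxx.
by case: pickP => [j' /eqP /g_inj -> //|/(_ j)]; rewrite eqxx.
Qed.

Variables (p : {set {set I}}) (q : {set {set J}}).

(** A class map whose level sets are the cells: partitions are easier to compare
    through the equivalence relation they define than as sets of sets. *)
Definition glue_class : K -> {set I} + {set J} :=
  glue_fun (inl finset.set0) (fun i => inl (finset.pblock p i))
    (fun j => inr (finset.pblock q j)).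

Lemma glue_class_f i : glue_class (f i) = inl (finset.pblock p i).
Proof. exact: glue_fun_f. Qed.

Lemma glue_class_g j : glue_class (g j) = inr (finset.pblock q j).
Proof. exact: glue_fun_g. Qed.

(** The partition of [K] whose cells are the images of those of [p] and [q]. *)
Definition glue : {set {set K}} := preim_partition glue_class [set: K]%SET.

Definition pull (L : finType) (h : L -> K) (P : {set {set K}}) : {set {set L}} :=
  preim_partition (fun l => finset.pblock P (h l)) [set: L]%SET.

Lemma glue_partition : finset.partition glue [set: K]%SET.
Proof. exact: preim_partitionT. Qed.

Lemma pull_glue_f : finset.partition p [set: I]%SET -> pull f glue = p.
Proof.
move=> pT; rewrite -[RHS](preim_partition_pblock pT); apply: eq_preim_partition => x y.
by rewrite eq_pblock_preim !glue_class_f.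
Qed.

Lemma pull_glue_g : finset.partition q [set: J]%SET -> pull g glue = q.
Proof.
move=> qT; rewrite -[RHS](preim_partition_pblock qT); apply: eq_preim_partition => x y.
by rewrite eq_pblock_preim !glue_class_g.
Qed.

Lemma glue_not_mixed i j : finset.pblock glue (f i) != finset.pblock glue (g j).
Proof. by rewrite eq_pblock_preim glue_class_f glue_class_g. Qed.

Lemma pblock_glue_f i : finset.partition p [set: I]%SET ->
  finset.pblock glue (f i) = [set f x | x in finset.pblock p i]%SET.
Proof.
move=> pT; apply/setP => k; rewrite mem_pblock_preim glue_class_f.
apply/eqP/imsetP => [|[i' i'p ->]]; last first.
  by rewrite glue_class_f; congr inl; apply/eqP; rewrite eq_pblockT.
case: (fg_cover k) => [[i' ->]|[j ->]]; last by rewrite glue_class_g.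
rewrite glue_class_f => -[/eqP]; rewrite eq_pblockT// => i'p.
by exists i'.
Qed.

Lemma pblock_glue_g j : finset.partition q [set: J]%SET ->
  finset.pblock glue (g j) = [set g x | x in finset.pblock q j]%SET.
Proof.
move=> qT; apply/setP => k; rewrite mem_pblock_preim glue_class_g.
apply/eqP/imsetP => [|[j' j'q ->]]; last first.
  by rewrite glue_class_g; congr inr; apply/eqP; rewrite eq_pblockT.
case: (fg_cover k) => [[i ->]|[j' ->]]; first by rewrite glue_class_f.
rewrite glue_class_g => -[/eqP]; rewrite eq_pblockT// => j'q.
by exists j'.
Qed.

Lemma big_glue (A : Type) (idx : A) (op : Monoid.com_law idx)
    (s : pred I) (r : pred J) (F : {set K} -> A) :
  finset.partition p [set: I]%SET -> finset.partition q [set: J]%SET ->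
  (forall C, C \in p -> exists j, forall i, (i \in C) && s i = (i == j)) ->
  (forall D, D \in q -> exists j, forall i, (i \in D) && r i = (i == j)) ->
  \big[op/idx]_(C in glue) F C =
  op (\big[op/idx]_(i | s i) F [set f x | x in finset.pblock p i]%SET)
     (\big[op/idx]_(j | r j) F [set g x | x in finset.pblock q j]%SET).
Proof.
move=> pT qT sp rq.
pose u k := [exists i, (f i == k) && s i] || [exists j, (g j == k) && r j].
have uf i : u (f i) = s i.
  apply/orP/idP => [[/existsP[i' /andP[/eqP/f_inj -> //]]|/existsP[j /andP[/eqP E _]]]|si].
    by have := fg_disj i j; rewrite E eqxx.
  by left; apply/existsP; exists i; rewrite eqxx.
have ug j : u (g j) = r j.
  apply/orP/idP => [[/existsP[i /andP[/eqP E _]]|/existsP[j' /andP[/eqP/g_inj -> //]]]|rj].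
    by have := fg_disj i j; rewrite E eqxx.
  by right; apply/existsP; exists j; rewrite eqxx.
rewrite (big_transversal glue_partition op (s := u)).
  rewrite big_images; congr (op _ _).
    by apply: eq_big => [i|i _]; rewrite ?uf ?pblock_glue_f.
  by apply: eq_big => [j|j _]; rewrite ?ug ?pblock_glue_g.
move=> C CG; have [k kC] : exists k, k \in C.
  by apply/set0Pn; apply: contraTneq CG => ->; have /and3P[] := glue_partition.
rewrite -(pblockT_id glue_partition CG kC).
case: (fg_cover k) => [[i ->]|[j ->]].
  have [i0 i0E] := sp _ (pblockT_mem pT i); exists (f i0) => k'.
  rewrite pblock_glue_f//; case: (fg_cover k') => [[i' ->]|[j' ->]].
    by rewrite uf mem_imset// i0E (inj_eq f_inj).
  rewrite eq_sym (negbTE (fg_disj _ _)); apply/andP => -[/imsetP[x _ E]].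
  by have := fg_disj x j'; rewrite E eqxx.
have [j0 j0E] := rq _ (pblockT_mem qT j); exists (g j0) => k'.
rewrite pblock_glue_g//; case: (fg_cover k') => [[i' ->]|[j' ->]].
  rewrite (negbTE (fg_disj _ _)); apply/andP => -[/imsetP[x _ E]].
  by have := fg_disj i' x; rewrite E eqxx.
by rewrite ug mem_imset// j0E (inj_eq g_inj).
Qed.

End Glue.

(** A partition without mixed cells is recovered from its two traces; with
    [pull_glue_f] and [pull_glue_g], gluing is a bijection from pairs of
    partitions onto the partitions without mixed cells. *)
Lemma glue_pull (I J K : finType) (f : I -> K) (g : J -> K) (P : {set {set K}}) :
  injective f -> injective g -> (forall i j, f i != g j) ->
  (forall k, (exists i, k = f i) \/ (exists j, k = g j)) ->
  finset.partition P [set: K]%SET ->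
  (forall i j, finset.pblock P (f i) != finset.pblock P (g j)) ->
  glue f g (pull f P) (pull g P) = P.
Proof.
move=> f_inj g_inj fg_disj fg_cover PT P_not_mixed.
rewrite -[RHS](preim_partition_pblock PT); apply: eq_preim_partition => x y.
have E := (@glue_class_f _ _ _ f g f_inj, @glue_class_g _ _ _ f g g_inj fg_disj).
case: (fg_cover x) => [[i ->]|[j ->]]; case: (fg_cover y) => [[i' ->]|[j' ->]];
  rewrite !E.
- by rewrite -(eq_pblock_preim (fun l => finset.pblock P (f l)) i i').
- by rewrite (negbTE (P_not_mixed _ _)).
- by rewrite eq_sym [RHS]eq_sym (negbTE (P_not_mixed _ _)).
- by rewrite -(eq_pblock_preim (fun l => finset.pblock P (g l)) j j').
Qed.

Section GluePaths.
Variables (N n : nat) (posY : 'I_n -> 'I_N) (posZ : 'I_(N - n) -> 'I_N).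
Hypotheses (Y_inj : injective posY) (Z_inj : injective posZ)
  (YZ_disj : forall i j, posY i != posZ j)
  (YZ_cover : forall k, (exists i, k = posY i) \/ (exists j, k = posZ j)).
Variables (p : {set {set 'I_n}}) (q : {set {set 'I_(N - n)}})
  (Sp : spath n) (Sm : spath (N - n)).
Hypotheses (pSp : corresponds p Sp) (qSm : corresponds q Sm).

Lemma perm_cell_sizes_jumps m (r : {set {set 'I_m}}) S : corresponds r S ->
  perm_eq (cell_sizes r) (jumps S).
Proof.
move=> rS; have rT := corresponds_partition rS.
apply/permP => a; rewrite -!sum1_count /cell_sizes /jumps.
rewrite !big_map big_filter_cond !big_enum_cond /=.
rewrite big_mkcondr (big_transversal rT _ (s := fun j => (0 < jump S j)%N)); last first.
  by move=> C Cr; exact: (corresponds_transversal rS).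
rewrite [RHS]big_mkcondr; apply: eq_bigr => j jS.
by rewrite (corresponds_card rS).
Qed.

Lemma perm_cell_sizes_glue :
  perm_eq (cell_sizes (glue posY posZ p q)) (jumps Sp ++ jumps Sm).
Proof.
have pT := corresponds_partition pSp; have qT := corresponds_partition qSm.
apply/permP => a; rewrite count_cat -!sum1_count /cell_sizes /jumps !big_map.
rewrite [X in (_ = X + _)%N]big_filter_cond [X in (_ = _ + X)%N]big_filter_cond.
rewrite !big_enum_cond /= big_mkcondr.
rewrite (big_glue Y_inj Z_inj YZ_disj YZ_cover _ (s := fun j => (0 < jump Sp j)%N)
  (r := fun j => (0 < jump Sm j)%N))//; last 2 first.
- by move=> C Cr; exact: (corresponds_transversal pSp).
- by move=> C Cr; exact: (corresponds_transversal qSm).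
congr (_ + _)%N; rewrite [RHS]big_mkcondr; apply: eq_bigr => j jS.
  by rewrite card_imset// (corresponds_card pSp).
by rewrite card_imset// (corresponds_card qSm).
Qed.

End GluePaths.

(** * The law of the induced partition *)

Section LatentPartition.
Context (R : realType) (d : measure_display) (Omega : measurableType d)
  (P : probability Omega R) (H : probability (measurableTypeR R) R)
  (G : Omega -> probability (measurableTypeR R) R) (chi : seq nat -> R)
  (theta : R) (N : nat) (X T : 'I_N -> {RV P >-> measurableTypeR R}).
Local Notation S := (measurableTypeR R).
Hypothesis H0 : forall x, H [set x] = 0%E.
Hypothesis hchi : is_eppf P H G chi.
Hypothesis hXT : latent_model theta G X T.

Lemma cell_sizes_gt0 m (p : {set {set 'I_m}}) :
  finset.partition p [set: 'I_m]%SET -> all (leq 1) (cell_sizes p).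
Proof.
move=> /and3P[_ _ p0]; apply/allP => k /mapP[C]; rewrite mem_enum => Cp ->.
by rewrite card_gt0; apply/eqP => CE; move: p0; rewrite -CE Cp.
Qed.

Let eppf_sum m (A : 'I_m -> set S) : R :=
  \sum_(p : {set {set 'I_m}} | finset.partition p [set: 'I_m]%SET)
    chi (cell_sizes p) *
    \prod_(C : {set 'I_m} | C \in p) fine (H (\bigcap_(i in [set i | i \in C]) A i)).

Let mcap m (C : {set 'I_m}) (A : 'I_m -> set S) : (forall i, measurable (A i)) ->
  measurable (\bigcap_(i in [set i | i \in C]) A i).
Proof. by move=> mA; apply: fin_bigcap_measurable. Qed.

Let drop0 (B : set S) : measurable B -> H (B `&` ~` [set 0]) = H B.
Proof.
move=> mB; rewrite [RHS](measureDI H mB (measurable_set1 (0 : R)))// setDE.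
rewrite [X in (_ + X)%E](_ : _ = 0%E) ?adde0//.
apply/eqP; rewrite eq_le measure_ge0 andbT -(H0 0).
by apply: le_measure; rewrite ?inE//; exact: measurableI.
Qed.

Let eppf_sum_drop0 m (A : 'I_m -> set S) : (forall i, measurable (A i)) ->
  eppf_sum (fun i => A i `&` ~` [set 0]) = eppf_sum A.
Proof.
move=> mA; apply: eq_bigr => p pT; congr (_ * _); apply: eq_bigr => C Cp.
have [i0 iC] : exists i, i \in C.
  by apply/set0Pn; apply: contraTneq Cp => ->; have /and3P[] := pT.
rewrite -[in RHS]drop0; last exact: mcap.
congr (fine (H _)); apply/seteqP; split => x /=.
  by move=> h; split; [move=> i iC'; have [] := h i iC'|have [] := h i0 iC].
by move=> [h1 h2] i iC'; split => //; exact: h1.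
Qed.

Let latent_rectangle (A : 'I_N -> set S) : (forall k, measurable (A k)) ->
  fine (P [set w | forall k, A k (X k w)]) =
  (\int[P]_w \prod_(k < N) fine (G w (A k `&` ~` [set 0%R])))%R.
Proof.
move=> mA.
have setTG : sigma_of G setT.
  by rewrite -setC0 -setTD; apply: sigma_algebraCD; exact: sigma_algebra0.
have := hXT setTG mA (fun _ : 'I_N => @measurableT _ S).
rewrite setTI (_ : mkset _ = [set w | forall k, A k (X k w)]); last first.
  by apply/seteqP; split => w /= h k //; have [] := h k.
move=> ->; apply: eq_Rintegral => w _; apply: eq_bigr => k _; congr fine.
under eq_integral => x _ do rewrite (integral_kern theta x).
have -> : G w (A k `&` ~` [set 0%R]) = (\int[G w]_x (\1_(A k `&` ~` [set 0%R]) x)%:E)%E.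
  by rewrite integral_indic ?setIT//; apply: measurableI => //; exact: measurableC.
rewrite [LHS]integral_mkcond; apply: eq_integral => x _.
rewrite patchE indicE in_setI; case: (x \in A k) => //=; congr (_%:R%:E)%E.
by congr nat_of_bool; apply/idP/idP; rewrite in_setC;
  [move=> x0; apply: contra x0; rewrite inE => ->|
  apply: contra => /eqP ->; rewrite inE].
Qed.

(** The latent values with labels in the range of [f] follow the partition
    formula of a sample of size [m]. The value zero, excluded in the model, can
    be put back because [H] has no atoms; the formula for [N] draws then gives
    an expectation in which the other factors are one, to which the formula
    for [m] draws applies. *)
Lemma subsample_law m (f : 'I_m -> 'I_N) : injective f ->
  forall A : 'I_m -> set S, (forall i, measurable (A i)) ->
  P [set w | forall i, A i (X (f i) w)] =
  (\sum_(p : {set {set 'I_m}} | finset.partition p [set: 'I_m]%SET)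
    (chi (cell_sizes p))%:E *
    \prod_(C in p) H (\bigcap_(i in [set i | i \in C]) A i))%E.
Proof.
move=> f_inj A mA.
pose A' k := if [pick i | f i == k] is Some i then A i else setT.
have A'f i : A' (f i) = A i.
  by rewrite /A'; case: pickP => [j /eqP /f_inj ->|/(_ i)]//; rewrite eqxx.
have A'N k : k \notin codom f -> A' k = setT.
  rewrite /A'; case: pickP => // i /eqP <-; by rewrite codom_f.
have mA' k : measurable (A' k) by rewrite /A'; case: pickP.
have E : fine (P [set w | forall i, A i (X (f i) w)]) = eppf_sum A.
  rewrite (_ : mkset _ = [set w | forall k, A' k (X k w)]); last first.
    apply/seteqP; split => w /= h k; last by have := h (f k); rewrite A'f.
    have [/codomP[i ->]|kN] := boolP (k \in codom f); first by rewrite A'f.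
    by rewrite A'N.
  rewrite latent_rectangle// (eppf_law hchi (A := fun k => A' k `&` ~` [set 0])); last first.
    by move=> k; apply: measurableI => //; exact: measurableC.
  rewrite -/(eppf_sum _) eppf_sum_drop0// /eppf_sum -!(eppf_law hchi)//.
  apply: eq_Rintegral => w _.
  rewrite (bigID (mem (codom f))) /= [X in _ * X]big1 ?mulr1; last first.
    by move=> k kN; rewrite A'N// probability_setT.
  rewrite (eq_bigl (mem [set f i | i in [set: 'I_m]%SET]%SET)); last first.
    move=> k /=; apply/idP/idP => [/codomP[i ->]|/imsetP[i _ ->]]; last exact: codom_f.
    have : f i \in [set f i | i in [set: 'I_m]%SET]%SET by apply: imset_f; rewrite inE.
    by [].
  rewrite big_imset /=; last by move=> i j _ _; exact: f_inj.
  by apply: eq_big => [i|i _]; rewrite ?inE ?A'f.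
rewrite -[LHS]fineK ?E; last by apply: fin_num_measure; exact: measurable_rectangle.
rewrite /eppf_sum -sumEFin; apply: eq_bigr => p pT; rewrite EFinM -prodEFin.
congr (_ * _)%E; apply: eq_bigr => C Cp; rewrite fineK//.
by apply: fin_num_measure; exact: mcap.
Qed.

Lemma integral_subsample_coincidences m (f : 'I_m -> 'I_N) (f_inj : injective f)
    (Q : pred {ffun 'I_m * 'I_m -> bool}) (g : 'I_m -> S -> \bar R) :
  (forall i, measurable_fun setT (g i)) -> (forall i x, 0 <= g i x)%E ->
  (\int[P]_w ((Q (coincidences (fun i => X (f i) w)))%:R%:E * \prod_(i < m) g i (X (f i) w)) =
  \sum_(p | finset.partition p [set: 'I_m]%SET && Q (same_cell p))
    (chi (cell_sizes p))%:E * \prod_(C in p) \int[H]_x \prod_(i in C) g i x)%E.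
Proof.
move=> mg g0; apply: (integral_sample_coincidences H0 (X := fun i => X (f i))
  (c := fun p => chi (cell_sizes p))) => // [p pT|A mA].
  by apply: (eppf_ge0 hchi); exact: cell_sizes_gt0.
exact: subsample_law.
Qed.

Lemma measurable_sample_coincidences m (f : 'I_m -> 'I_N)
    (Q : pred {ffun 'I_m * 'I_m -> bool}) :
  measurable_fun setT (fun w => (Q (coincidences (fun i => X (f i) w)))%:R%:E : \bar R).
Proof.
apply/measurable_EFinP.
rewrite (_ : (fun w => _) = \1_[set u : m.-tuple S | Q (coincidences (tnth u))] \o
   sample (fun i => X (f i))).
  apply: measurableT_comp; last exact: (measurable_sample (fun i => X (f i))).
  by apply: measurable_indic; exact: measurable_coincidences.
apply/funext => w /=; rewrite indicE mem_setE /in_mem /=.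
suff -> : coincidences (tnth (sample (fun i => X (f i)) w)) =
    coincidences (fun i => X (f i) w) by [].
by apply/ffunP => ij; rewrite !ffunE !tnth_mktuple.
Qed.

(** The probability that a subsample induces exactly the partition [p] is the
    value of [chi] at the cell sizes of [p]. *)
Lemma integral_same_cell m (f : 'I_m -> 'I_N) (f_inj : injective f) (p : {set {set 'I_m}}) :
  finset.partition p [set: 'I_m]%SET ->
  (\int[P]_w (coincidences (fun i => X (f i) w) == same_cell p)%:R%:E =
   (chi (cell_sizes p))%:E)%E.
Proof.
move=> pT.
have := @integral_subsample_coincidences m f f_inj (pred1 (same_cell p)) (fun _ _ => 1%E).
move=> /(_ (fun=> measurable_cst _) (fun _ _ => lee01)).
under eq_integral do rewrite big1// mule1.
move=> ->; rewrite (big_pred1 p) => [|q /=].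
  rewrite big1 ?mule1// => C Cp.
  rewrite (_ : (fun _ => _) = cst 1%E) ?integral_cst// ?mul1e; first exact: probability_setT.
  by apply/funext => x; rewrite big1.
apply/andP/eqP => [[qT /eqP qp]|->]; last by [].
rewrite -(preim_partition_pblock qT) -[RHS](preim_partition_pblock pT).
apply: eq_preim_partition => x y.
by have := congr1 (fun h : {ffun _} => h (x, y)) qp; rewrite !ffunE.
Qed.

End LatentPartition.

(** * Contribution of a cell to the likelihood *)

Section Ordering.
Context (R : realType) (theta : R) (N n : nat) (t : 'I_N -> R)
  (posY : 'I_n -> 'I_N) (posZ : 'I_(N - n) -> 'I_N).
Hypothesis ord : ordering theta t posY posZ.

Lemma posY_inj : injective posY.
Proof.
move=> i j ij; apply/val_inj; have [lt|lt|//] := ltngtP i j.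
  by have := ordering_Y_incr ord lt; rewrite ij ltxx.
by have := ordering_Y_incr ord lt; rewrite ij ltxx.
Qed.

Lemma posZ_inj : injective posZ.
Proof.
move=> i j ij; apply/val_inj; have [lt|lt|//] := ltngtP i j.
  by have := ordering_Z_decr ord lt; rewrite ij ltxx.
by have := ordering_Z_decr ord lt; rewrite ij ltxx.
Qed.

Lemma posYZ_disjoint i j : posY i != posZ j.
Proof.
apply/eqP => ij; have := ordering_Y_gt0 ord i; rewrite ij.
by rewrite ltNge (ltW (ordering_Z_lt0 ord j)).
Qed.

Lemma posYZ_cover k : (exists i, k = posY i) \/ (exists j, k = posZ j).
Proof.
pose h (x : 'I_n + 'I_(N - n)) := match x with inl i => posY i | inr j => posZ j end.
have h_inj : injective h.
  move=> [i|j] [i'|j'] /= E.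
  - by rewrite (posY_inj E).
  - by have := posYZ_disjoint i j'; rewrite E eqxx.
  - by have := posYZ_disjoint i' j; rewrite E eqxx.
  - by rewrite (posZ_inj E).
have nN : (n <= N)%N.
  by have := leq_card posY posY_inj; rewrite !card_ord.
have : k \in codom h.
  rewrite inj_card_onto//.
  by rewrite card_sum !card_ord subnKC.
by move=> /codomP[[i|j] ->]; [left; exists i|right; exists j].
Qed.

Lemma Y_le (i j : 'I_n) : (i <= j)%N -> t (posY i) - theta <= t (posY j) - theta.
Proof.
by rewrite leq_eqVlt => /orP[/eqP/val_inj ->//|/(ordering_Y_incr ord)/ltW].
Qed.

Lemma Z_ge (i j : 'I_(N - n)) : (i <= j)%N -> t (posZ j) - theta <= t (posZ i) - theta.
Proof.
by rewrite leq_eqVlt => /orP[/eqP/val_inj ->//|/(ordering_Z_decr ord)/ltW].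
Qed.

End Ordering.

(** Used with [b i] the condition that the latent value is beyond observation
    [i]: within a cell only the condition for the extreme observation [j]
    remains. *)
Lemma prod_threshold (R : realType) (I : finType) (C : {set I}) (j : I) (a : R)
    (b : I -> bool) : j \in C -> (forall i, i \in C -> b j -> b i) ->
  \prod_(i in C) (a * (b i)%:R) = a ^+ #|C| * (b j)%:R.
Proof.
move=> jC bj; rewrite big_split/= prodr_const; congr (_ * _).
case: (boolP (b j)) => [bj1|bj0].
  by rewrite big1// => i iC; rewrite bj.
by rewrite (bigD1 j)//= (negbTE bj0) mul0r.
Qed.

Section CellIntegral.
Local Open Scope ereal_scope.
Context (R : realType) (H : probability (measurableTypeR R) R).
Local Notation S := (measurableTypeR R).

Lemma integral_bounded_EFin (D : set S) (f : S -> R) (M : R) :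
  measurable D -> measurable_fun setT f -> (forall x, D x -> 0 <= f x <= M)%R ->
  \int[H]_(x in D) (f x)%:E = (\int[H]_(x in D) f x)%R%:E.
Proof.
move=> mD mf fM; rewrite /Rintegral fineK// ge0_fin_numE; last first.
  by apply: integral_ge0 => x Dx; rewrite lee_fin; have /andP[] := fM x Dx.
apply: (@le_lt_trans _ _ (\int[H]_(x in D) (cst `|M|%R%:E) x)).
  apply: ge0_le_integral => //.
  - by move=> x Dx; rewrite lee_fin; have /andP[] := fM x Dx.
  - by apply/measurable_EFinP; exact: measurable_funTS.
  - by move=> x Dx; rewrite lee_fin; have /andP[_ /le_trans] := fM x Dx; apply; exact: ler_norm.
rewrite integral_cst// lte_mul_pinfty// ?lee_fin//.
by apply: (le_lt_trans (probability_le1 _ mD)); rewrite ltry.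
Qed.

Lemma integral_restrict (D : set S) (f : S -> R) :
  \int[H]_x (f x * \1_D x)%:E = \int[H]_(x in D) (f x)%:E.
Proof.
rewrite [RHS]integral_mkcond; apply: eq_integral => x _.
by rewrite patchE indicE; case: ifP => _; rewrite ?mulr1 ?mulr0.
Qed.

Lemma integral_power_pos (y : R) e (A : set S) : measurable A -> (0 < y)%R ->
  \int[H]_x (x^-1 ^+ e * (y <= x)%R%:R * \1_A x)%:E = (int_pos H y e A)%:E.
Proof.
move=> mA y0; rewrite /int_pos -(integral_bounded_EFin (M := y ^- e)); last 3 first.
- by apply: measurableI => //; exact: measurable_itv.
- by apply: measurable_inv; exact: measurable_funX.
- move=> x [_ /=]; rewrite in_itv/= andbT => yx.
  have x0 : (0 < x)%R by exact: lt_le_trans yx.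
  rewrite invr_ge0 exprn_ge0 ?(ltW x0)//=.
  have : (y ^+ e <= x ^+ e)%R by apply: lerXn2r => //; rewrite nnegrE ltW.
  by rewrite -lef_pV2 ?posrE ?exprn_gt0.
rewrite -integral_restrict; apply: eq_integral => x _; congr EFin.
rewrite exprVn !indicE in_setI mem_setE in_itv/= andbT -mulrA; congr (_ * _)%R.
by case: (y <= x)%R; rewrite ?andbT ?andbF ?mul1r ?mul0r.
Qed.

Lemma integral_power_neg (z : R) e (B : set S) : measurable B -> (z < 0)%R ->
  \int[H]_x ((- x)^-1 ^+ e * (x <= z)%R%:R * \1_B x)%:E = (int_neg H z e B)%:E.
Proof.
move=> mB z0; rewrite /int_neg -(integral_bounded_EFin (M := (- z) ^- e)); last 3 first.
- by apply: measurableI => //; exact: measurable_itv.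
- apply: measurable_inv; apply: measurable_funX; exact: measurable_funN.
- move=> x [_ /=]; rewrite in_itv/= => xz.
  have x0 : (0 < - x)%R by rewrite oppr_gt0; exact: le_lt_trans z0.
  rewrite invr_ge0 exprn_ge0 ?(ltW x0)//=.
  have nz0 : (0 < - z)%R by rewrite oppr_gt0.
  have : ((- z) ^+ e <= (- x) ^+ e)%R by apply: lerXn2r; rewrite ?lerN2// nnegrE ltW.
  by rewrite -lef_pV2 ?posrE ?exprn_gt0.
rewrite -integral_restrict; apply: eq_integral => x _; congr EFin.
rewrite exprVn !indicE in_setI mem_setE in_itv/= -mulrA; congr (_ * _)%R.
by case: (x <= z)%R; rewrite ?andbT ?andbF ?mul1r ?mul0r.
Qed.

Context (theta : R) (N m : nat) (t : 'I_N -> R) (pos : 'I_m -> 'I_N) (S0 : spath m)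
  (p : {set {set 'I_m}}) (A : 'I_m -> set S) (A' : 'I_N -> set S).
Hypotheses (pos_inj : injective pos) (pS : corresponds p S0)
  (mA : forall j, measurable (A j))
  (A'pos : forall j, A' (pos j) = if (0 < jump S0 j)%N then A j else setT).

Let block j := [set pos i | i in finset.pblock p j]%SET.

Lemma prod_indic_cell j x : (0 < jump S0 j)%N ->
  (\prod_(i in finset.pblock p j) \1_(A' (pos i)) x = \1_(A j) x :> R)%R.
Proof.
move=> jS; have pT := corresponds_partition pS.
rewrite (bigD1 j) ?mem_pblockT//= A'pos jS big1 ?mulr1// => i /andP[ip ij].
rewrite A'pos; case: ifPn => [iS|_]; last by rewrite indicT.
have [j0 j0E] := corresponds_transversal pS (pblockT_mem pT j).
have := j0E i; rewrite ip iS => /esym/eqP ii.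
have := j0E j; rewrite mem_pblockT// jS => /esym/eqP jj.
by rewrite ii jj eqxx in ij.
Qed.

(** A common latent value [x] of a cell must exceed all the observations of the
    cell, hence the one with the largest label, and contributes [x^-1] for each
    of them. *)
Lemma integral_cell_pos j : (0 < jump S0 j)%N ->
  (forall i, 0 < t (pos i) - theta)%R ->
  (forall i j : 'I_m, (i <= j)%N -> t (pos i) - theta <= t (pos j) - theta)%R ->
  \int[H]_x \prod_(k in block j) (kern theta x (t k) * \1_(A' k) x)%:E =
  (int_pos H (t (pos j) - theta) (jump S0 j) (A j))%:E.
Proof.
move=> jS t0 t_le; have pT := corresponds_partition pS.
have /andP[jj /forall_inP jmax] : is_max_of j (finset.pblock p j).
  by rewrite -(corresponds_maxP _ pS).
rewrite -integral_power_pos//; apply: eq_integral => x _.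
rewrite prodEFin big_imset /=; last by move=> i i' _ _; exact: pos_inj.
rewrite big_split/= prod_indic_cell//; congr (_ * _)%:E.
under eq_bigr do rewrite kern_pos//.
rewrite (prod_threshold (j := j))// ?(corresponds_card pS)// => i /jmax ij.
exact/le_trans/t_le.
Qed.

Lemma integral_cell_neg j : (0 < jump S0 j)%N ->
  (forall i, t (pos i) - theta < 0)%R ->
  (forall i j : 'I_m, (i <= j)%N -> t (pos j) - theta <= t (pos i) - theta)%R ->
  \int[H]_x \prod_(k in block j) (kern theta x (t k) * \1_(A' k) x)%:E =
  (int_neg H (t (pos j) - theta) (jump S0 j) (A j))%:E.
Proof.
move=> jS t0 t_ge; have pT := corresponds_partition pS.
have /andP[jj /forall_inP jmax] : is_max_of j (finset.pblock p j).
  by rewrite -(corresponds_maxP _ pS).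
rewrite -integral_power_neg//; apply: eq_integral => x _.
rewrite prodEFin big_imset /=; last by move=> i i' _ _; exact: pos_inj.
rewrite big_split/= prod_indic_cell//; congr (_ * _)%:E.
under eq_bigr do rewrite kern_neg//.
rewrite (@prod_threshold _ _ _ j _ (fun i => x <= t (pos i) - theta)%R)//.
  by rewrite (corresponds_card pS).
by move=> i /jmax ij /le_trans; apply; exact: t_ge.
Qed.

End CellIntegral.

(** * Posterior of the paths and of the unique values *)

Section UniqueValues.
Context (R : realType) (N m : nat) (pos : 'I_m -> 'I_N) (S : spath m) (x : 'I_N -> R)
  (b : pred R).
Hypotheses (xS : corresponds (label_partition pos x) S)
  (b_pos : forall i, b (x (pos i)))
  (pos_b : forall k, b (x k) -> exists i, k = pos i).

(** The maxima of the cells, which are the jumps of the path, form a system of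
    representatives of the coincidence classes. *)
Lemma perm_unique_values :
  perm_eq (undup [seq x k | k <- enum 'I_N & b (x k)])
    [seq x (pos j) | j <- enum 'I_m & (0 < jump S j)%N].
Proof.
have pT : finset.partition (label_partition pos x) [set: 'I_m]%SET by exact: preim_partitionT.
apply: uniq_perm; first exact: undup_uniq.
  rewrite map_inj_in_uniq; first by apply: filter_uniq; exact: enum_uniq.
  move=> i j.
  rewrite !mem_filter => /andP[iS _] /andP[jS _] xij.
  have [j0 j0E] := corresponds_transversal xS (pblockT_mem pT i).
  have := j0E i; rewrite mem_pblockT// iS => /esym/eqP ->.
  have := j0E j; rewrite (mem_pblock_preim (fun j => x (pos j))) xij eqxx jS => /esym/eqP ->.
  by [].
move=> y; rewrite mem_undup; apply/mapP/mapP => -[k].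
  rewrite mem_filter => /andP[bk _] ->; have [i ->] := pos_b bk.
  have [j jE] := corresponds_transversal xS (pblockT_mem pT i).
  have /andP[ji jS] : (j \in finset.pblock (label_partition pos x) i) && (0 < jump S j)%N.
    by rewrite jE.
  exists j; first by rewrite mem_filter jS mem_enum.
  by apply/eqP; rewrite -(mem_pblock_preim (fun j => x (pos j))).
by rewrite mem_filter => /andP[_ _] ->; exists (pos k) => //; rewrite mem_filter b_pos mem_enum.
Qed.

Lemma size_unique_values : size (undup [seq x k | k <- enum 'I_N & b (x k)]) = n_cells S.
Proof.
rewrite (perm_size perm_unique_values) size_map size_filter -sum1_count big_enum_cond /=.
by rewrite big_mkcond /n_cells; apply: eq_bigr => j _; case: (0 < _)%N.
Qed.

End UniqueValues.

Section PosteriorLaw.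
Context (R : realType) (d : measure_display) (Omega : measurableType d)
  (P : probability Omega R) (H : probability (measurableTypeR R) R)
  (G : Omega -> probability (measurableTypeR R) R) (chi : seq nat -> R)
  (theta : R) (N : nat) (X T : 'I_N -> {RV P >-> measurableTypeR R}).
Local Notation S := (measurableTypeR R).
Hypothesis H0 : forall x, H [set x] = 0%E.
Hypothesis hchi : is_eppf P H G chi.
Hypothesis hXT : latent_model theta G X T.
Context (t : 'I_N -> R) (n : nat) (posY : 'I_n -> 'I_N) (posZ : 'I_(N - n) -> 'I_N).
Hypothesis ord : ordering theta t posY posZ.

Let Y_inj := posY_inj ord.
Let Z_inj := posZ_inj ord.
Let YZ_disj := posYZ_disjoint ord.
Let YZ_cover := posYZ_cover ord.
Local Notation glueYZ := (glue posY posZ).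

(** The event that the sample has paths [Sm] and [Sp], read off from its
    coincidences. *)
Definition path_pattern (Sm : spath (N - n)) (Sp : spath n)
    (r : {ffun 'I_N * 'I_N -> bool}) : bool :=
  corresponds (finset.equivalence_partition (fun i j => r (posZ i, posZ j)) [set: _]%SET) Sm &&
  corresponds (finset.equivalence_partition (fun i j => r (posY i, posY j)) [set: _]%SET) Sp.

Lemma path_pattern_event Sm Sp (x : 'I_N -> R) :
  path_pattern Sm Sp (coincidences x) <-> paths_event posY posZ Sm Sp x.
Proof.
rewrite /path_pattern /paths_event /= /label_partition /preim_partition.
rewrite (eq_equivalence_partition (e' := fun i j => x (posZ i) == x (posZ j))); last first.
  by move=> i j; rewrite ffunE.
rewrite (eq_equivalence_partition (e' := fun i j => x (posY i) == x (posY j))); last first.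
  by move=> i j; rewrite ffunE.
by split => [/andP|/andP].
Qed.

Lemma path_pattern_cell Sm Sp p :
  path_pattern Sm Sp (same_cell p) =
  corresponds (pull posZ p) Sm && corresponds (pull posY p) Sp.
Proof.
rewrite /path_pattern /pull /preim_partition.
rewrite (eq_equivalence_partition
    (e' := fun i j => finset.pblock p (posZ i) == finset.pblock p (posZ j)));
  last by move=> i j; rewrite ffunE.
by rewrite (eq_equivalence_partition
    (e' := fun i j => finset.pblock p (posY i) == finset.pblock p (posY j)));
  last by move=> i j; rewrite ffunE.
Qed.

Section Evaluation.
Variables (Sm : spath (N - n)) (Sp : spath n).
Variables (A : 'I_n -> set S) (B : 'I_(N - n) -> set S).
Hypotheses (mA : forall j, measurable (A j)) (mB : forall j, measurable (B j)).

(** The constraints on the unique values, attached to the labels: only the label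
    that is the maximum of its cell carries one. *)
Definition value_set : 'I_N -> set S :=
  glue_fun posY posZ setT (fun i => if (0 < jump Sp i)%N then A i else setT)
    (fun j => if (0 < jump Sm j)%N then B j else setT).

Let value_setY i : value_set (posY i) = if (0 < jump Sp i)%N then A i else setT.
Proof. exact: glue_fun_f. Qed.

Let value_setZ j : value_set (posZ j) = if (0 < jump Sm j)%N then B j else setT.
Proof. exact: glue_fun_g. Qed.

Let mvalue_set k : measurable (value_set k).
Proof.
by case: (YZ_cover k) => [[i ->]|[j ->]]; rewrite ?value_setY ?value_setZ; case: ifP.
Qed.

Lemma value_setP x : UV_event posY posZ Sm Sp A B x <-> forall k, value_set k (x k).
Proof.
split => [[xA xB] k|xk].
  by case: (YZ_cover k) => [[i ->]|[j ->]]; rewrite ?value_setY ?value_setZ; case: ifPn => //;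
    [exact: xA|exact: xB].
split=> j jS; first by have := xk (posY j); rewrite value_setY jS.
by have := xk (posZ j); rewrite value_setZ jS.
Qed.


Local Open Scope ereal_scope.

Let dens k (x : S) : \bar R := (kern theta x (t k) * \1_(value_set k) x)%:E.

Let mdens k : measurable_fun setT (dens k).
Proof.
apply/measurable_EFinP; apply: measurable_funM; first by apply: measurable_kern2.
exact: measurable_indic.
Qed.

Let dens_ge0 k x : 0 <= dens k x.
Proof. by rewrite lee_fin mulr_ge0 ?kern_ge0. Qed.

Lemma bayes_num_pattern :
  bayes_num theta X t (paths_event posY posZ Sm Sp `&` UV_event posY posZ Sm Sp A B) =
  \int[P]_w ((path_pattern Sm Sp (coincidences (X^~ w)))%:R%:E *
    \prod_(k < N) dens k (X k w)).
Proof.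
rewrite /bayes_num integral_mkcond; apply: eq_integral => w _; rewrite patchE.
rewrite prodEFin big_split/= -EFinM; case: ifPn => [|wD].
  rewrite inE => -[/path_pattern_event -> /value_setP xA].
  by rewrite mul1r [X in _ = (_ * X)%:E]big1 ?mulr1// => k _; rewrite indicE mem_set.
have [pat|] := boolP (path_pattern _ _ _); last by rewrite mul0r.
have [k xk] : exists k, ~ value_set k (X k w).
  apply: contrapT => h; move/negP: wD; apply; rewrite inE; split.
    exact/path_pattern_event.
  by apply/value_setP => k; apply: contrapT => h'; apply: h; exists k.
by rewrite [X in _ = (_ * (_ * X))%:E](bigD1 k)//= indicE memNset// mul0r !mulr0.
Qed.

Definition path_mass : R :=
  (\prod_(j < n | (0 < jump Sp j)%N) int_pos H (t (posY j) - theta) (jump Sp j) (A j) *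
   \prod_(j < N - n | (0 < jump Sm j)%N) int_neg H (t (posZ j) - theta) (jump Sm j) (B j))%R.

(* a latent value cannot lie both above a positive and below a negative
   observation *)
Let mixed_cell (p : {set {set 'I_N}}) i j : finset.partition p [set: 'I_N]%SET ->
  finset.pblock p (posY i) == finset.pblock p (posZ j) ->
  \prod_(C in p) \int[H]_x \prod_(k in C) dens k x = 0.
Proof.
move=> pT ij; rewrite (bigD1 (finset.pblock p (posY i))) ?pblockT_mem//=.
rewrite (_ : (fun x => _) = cst 0) ?integral0 ?mul0e//.
apply/funext => x; rewrite (bigD1 (posY i)) ?mem_pblockT//= (bigD1 (posZ j)) /=; last first.
  by rewrite -eq_pblockT// ij eq_sym YZ_disj.
rewrite muleA -EFinM /dens kern_pos ?(ordering_Y_gt0 ord)// kern_neg ?(ordering_Z_lt0 ord)//.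
have [xY|_] := leP (t (posY i) - theta)%R x; last by rewrite mulr0 !mul0r mul0e.
have [xZ|_] := leP x (t (posZ j) - theta)%R; last by rewrite !(mulr0, mul0r) mul0e.
have := le_lt_trans (le_trans xY xZ) (ordering_Z_lt0 ord j).
by rewrite ltNge (ltW (ordering_Y_gt0 ord i)).
Qed.

Lemma glue_cell_value p q : corresponds p Sp -> corresponds q Sm ->
  (chi (cell_sizes (glueYZ p q)))%:E *
    \prod_(C in glueYZ p q) \int[H]_x \prod_(k in C) dens k x =
  (chi (jumps Sp ++ jumps Sm) * path_mass)%:E.
Proof.
move=> pS qS.
rewrite (eppf_sym hchi (cell_sizes_gt0 (glue_partition posY posZ p q))
  (perm_cell_sizes_glue Y_inj Z_inj YZ_disj YZ_cover pS qS)) EFinM; congr (_ * _).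
rewrite (big_glue Y_inj Z_inj YZ_disj YZ_cover _ (s := fun j => (0 < jump Sp j)%N)
  (r := fun j => (0 < jump Sm j)%N)); first last.
- by move=> C Cr; exact: (corresponds_transversal qS).
- by move=> C Cr; exact: (corresponds_transversal pS).
- exact: corresponds_partition qS.
- exact: corresponds_partition pS.
rewrite /path_mass EFinM -!prodEFin; congr (_ * _); apply: eq_bigr => j jS.
- apply: (integral_cell_pos H Y_inj pS mA value_setY jS); first exact: (ordering_Y_gt0 ord).
  exact: (Y_le ord).
- apply: (integral_cell_neg H Z_inj qS mB value_setZ jS); first exact: (ordering_Z_lt0 ord).
  exact: (Z_ge ord).
Qed.

(** By [integral_sample_coincidences] the numerator is a sum over partitions.
    Those with a cell meeting both groups of labels contribute nothing; the
    others are glued from two partitions with paths [Sp] and [Sm], and all the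
    glued partitions contribute the same amount. *)
Lemma bayes_num_paths :
  bayes_num theta X t (paths_event posY posZ Sm Sp `&` UV_event posY posZ Sm Sp A B) =
  ((#|partitions_of Sp| * #|partitions_of Sm|)%:R *
   (chi (jumps Sp ++ jumps Sm) * path_mass))%:E.
Proof.
rewrite bayes_num_pattern.
rewrite (integral_subsample_coincidences H0 hchi hXT (f := id) (@inj_id _) (path_pattern Sm Sp)
  mdens dens_ge0).
rewrite (bigID (fun p : {set {set 'I_N}} =>
  [forall i, [forall j, finset.pblock p (posY i) != finset.pblock p (posZ j)]])) /=.
rewrite [X in _ + X]big1 ?adde0; last first.
  move=> p /andP[/andP[pT _] /forallPn[i /forallPn[j]]]; rewrite negbK => ij.
  by rewrite (mixed_cell pT ij) mule0.
rewrite (reindex_onto (fun pq : {set {set 'I_n}} * {set {set 'I_(N - n)}} => glueYZ pq.1 pq.2)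
  (fun p => (pull posY p, pull posZ p))) /=; last first.
  move=> p /andP[/andP[pT _] /forallP pYZ].
  by apply: glue_pull => // i j; have /forallP := pYZ i.
rewrite (eq_bigl (mem (finset.setX (partitions_of Sp) (partitions_of Sm)))); last first.
  move=> [p q] /=; rewrite glue_partition path_pattern_cell /=; apply/idP/idP.
    move=> /andP[/andP[/andP[qS pS] _] /eqP[pE qE]].
    by rewrite !inE /= -{1}pE pS -qE qS.
  rewrite !inE /= => /andP[pS qS].
  rewrite (@pull_glue_f _ _ _ posY posZ Y_inj) ?(corresponds_partition pS)//.
  rewrite (@pull_glue_g _ _ _ posY posZ Z_inj YZ_disj) ?(corresponds_partition qS)//.
  rewrite pS qS eqxx andbT; apply/forallP => i; apply/forallP => j.
  exact: glue_not_mixed.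
rewrite (eq_bigr (fun=> (chi (jumps Sp ++ jumps Sm) * path_mass)%:E)); last first.
  move=> [p q] /=; rewrite !inE /= => /andP[pS qS]; exact: glue_cell_value.
by rewrite sumEFin sumr_const cardsX mulr_natl.
Qed.

End Evaluation.

Local Open Scope ereal_scope.

(** Both values of [chi] are probabilities that a sample induces a given
    partition, and the second event is implied by the first. This settles the
    case of a vanishing denominator [chi (jumps Sp)] in [phi_neg]. *)
Lemma chi_cat_le (Sm : spath (N - n)) (Sp : spath n) p q : corresponds p Sp -> corresponds q Sm ->
  (0 <= chi (jumps Sp ++ jumps Sm) <= chi (jumps Sp))%R.
Proof.
move=> pS qS; have pT := corresponds_partition pS.
have gT := glue_partition posY posZ p q.
rewrite -(eppf_sym hchi (cell_sizes_gt0 pT) (perm_cell_sizes_jumps pS)).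
rewrite -(eppf_sym hchi (cell_sizes_gt0 gT)
  (perm_cell_sizes_glue Y_inj Z_inj YZ_disj YZ_cover pS qS)).
rewrite (eppf_ge0 hchi) ?cell_sizes_gt0//= -lee_fin.
rewrite -(integral_same_cell H0 hchi hXT Y_inj pT).
rewrite -(integral_same_cell H0 hchi hXT (f := id) (@inj_id _) gT).
apply: ge0_le_integral => //.
- exact: (measurable_sample_coincidences X id (pred1 (same_cell (glueYZ p q)))).
- exact: (measurable_sample_coincidences X posY (pred1 (same_cell p))).
move=> w _; rewrite lee_fin ler_nat; case: eqP => // E.
rewrite (_ : coincidences _ = same_cell p) ?eqxx//.
apply/ffunP => -[i j]; have := congr1 (fun h : {ffun _} => h (posY i, posY j)) E.
by rewrite !ffunE /= => ->; rewrite eq_pblock_preim !glue_class_f.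
Qed.

Local Notation mass Sm Sp := (path_mass Sm Sp (fun=> setT) (fun=> setT)).

Lemma phi_product Sm Sp :
  (phi_pos H chi theta t posY Sp * phi_neg H chi theta t posZ Sm Sp =
   (#|partitions_of Sp| * #|partitions_of Sm|)%:R *
   (chi (jumps Sp ++ jumps Sm) * mass Sm Sp))%R.
Proof.
rewrite /phi_pos /phi_neg /path_mass.
have [chi0|chi0] := eqVneq (chi (jumps Sp)) 0%R; last first.
  set a := (\prod_(j < n | _) _)%R; set b := (\prod_(j < N - n | _) _)%R.
  by rewrite natrM; field.
rewrite chi0 mulr0 !mul0r; have [->|[p]] := set_0Vmem (partitions_of Sp).
  by rewrite cards0 mul0n mul0r.
have [->|[q]] := set_0Vmem (partitions_of Sm); first by rewrite cards0 muln0 mul0r.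
rewrite !inE => qS pS; have := chi_cat_le pS qS; rewrite chi0 => chi_cat0.
by rewrite (_ : chi _ = 0%R) ?mul0r ?mulr0//; apply/eqP; rewrite eq_le andbC.
Qed.

Lemma bayes_num_paths_event Sm Sp :
  bayes_num theta X t (paths_event posY posZ Sm Sp) =
  (phi_pos H chi theta t posY Sp * phi_neg H chi theta t posZ Sm Sp)%:E.
Proof.
rewrite phi_product -(@bayes_num_paths Sm Sp (fun=> setT) (fun=> setT))//.
by congr (bayes_num _ _ _ _); apply/seteqP; split => [x xE|x []//].
Qed.

Let sum_paths (p : {set {set 'I_N}}) (v : \bar R) :
  \sum_(Sm : spath (N - n)) \sum_(Sp : spath n)
    (if path_pattern Sm Sp (same_cell p) then v else 0) = v.
Proof.
have [Sp0 pSp0] := path_exists (preim_partitionT (fun j => finset.pblock p (posY j))).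
have [Sm0 pSm0] := path_exists (preim_partitionT (fun j => finset.pblock p (posZ j))).
have E Sm Sp : path_pattern Sm Sp (same_cell p) = (Sm == Sm0) && (Sp == Sp0).
  rewrite path_pattern_cell; apply/andP/andP => [[pSm pSp]|[/eqP -> /eqP ->]//].
  by rewrite (corresponds_unique pSm pSm0) (corresponds_unique pSp pSp0).
rewrite (bigD1 Sm0)//= (bigD1 Sp0)//= E !eqxx/= big1 ?adde0; last first.
  by move=> Sp /negbTE Sp_neq; rewrite E eqxx Sp_neq.
rewrite big1 ?adde0// => Sm /negbTE Sm_neq.
by rewrite big1// => Sp _; rewrite E Sm_neq.
Qed.

(** Every partition corresponds to exactly one path for each group of labels, so
    that the sum over all partitions splits into the sums over the pairs of
    paths. *)
Lemma marginal_density_paths :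
  marginal_density theta X t =
  (\sum_(Sm : spath (N - n)) \sum_(Sp : spath n)
    phi_pos H chi theta t posY Sp * phi_neg H chi theta t posZ Sm Sp)%:E.
Proof.
pose dens k (x : S) : \bar R := (kern theta x (t k) * \1_(@setT S) x)%:E.
have mdens k : measurable_fun setT (dens k).
  apply/measurable_EFinP; apply: measurable_funM; first by apply: measurable_kern2.
  exact: measurable_indic.
have dens_ge0 k x : 0 <= dens k x by rewrite lee_fin mulr_ge0 ?kern_ge0.
pose cell (p : {set {set 'I_N}}) := (chi (cell_sizes p))%:E *
  \prod_(C in p) \int[H]_x \prod_(k in C) dens k x.
have pathE Sm Sp : (phi_pos H chi theta t posY Sp * phi_neg H chi theta t posZ Sm Sp)%:E =
    \sum_(p | finset.partition p [set: 'I_N]%SET)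
       if path_pattern Sm Sp (same_cell p) then cell p else 0.
  rewrite -bayes_num_paths_event -big_mkcondr.
  rewrite -(integral_subsample_coincidences H0 hchi hXT (f := id) (@inj_id _)
    (path_pattern Sm Sp) mdens dens_ge0).
  rewrite /bayes_num integral_mkcond; apply: eq_integral => w _; rewrite patchE.
  rewrite prodEFin -EFinM; under eq_bigr do rewrite indicT mulr1.
  have -> : (w \in [set w | paths_event posY posZ Sm Sp (fun k => X k w)]) =
      path_pattern Sm Sp (coincidences (X^~ w)).
    by apply/idP/idP; rewrite inE => /path_pattern_event.
  by case: ifP; rewrite ?mul1r ?mul0r.
have margE : marginal_density theta X t =
    \sum_(p | finset.partition p [set: 'I_N]%SET) cell p.
  have := integral_subsample_coincidences H0 hchi hXT (f := id) (@inj_id _) predT mdens dens_ge0.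
  under [in X in _ = X -> _]eq_bigl do rewrite andbT.
  move=> <-; rewrite marginal_densityE; apply: eq_integral => w _.
  by rewrite mul1e prodEFin; under [in RHS]eq_bigr do rewrite indicT mulr1.
rewrite margE -sumEFin; under [RHS]eq_bigr do rewrite -sumEFin.
under [RHS]eq_bigr do under eq_bigr do rewrite pathE.
under [RHS]eq_bigr do rewrite exchange_big.
rewrite exchange_big; apply: eq_bigr => p _.
by rewrite sum_paths.
Qed.

(** A nonzero likelihood forces the sign of each latent value to be that of its
    observation. *)
Lemma unique_values_on_paths (x : 'I_N -> R) Sm Sp : likelihood theta x t != 0%R ->
  paths_event posY posZ Sm Sp x -> unique_values_event posY posZ Sm Sp x.
Proof.
move=> lik [xm xp].
have kern_neq0 k : kern theta (x k) (t k) != 0%R.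
  by apply: contraNneq lik => k0; rewrite /likelihood (bigD1 k)//= k0 mul0r.
have xY i : (0 < x (posY i))%R.
  have := kern_neq0 (posY i); rewrite kern_pos ?(ordering_Y_gt0 ord)//.
  by case: (leP _ (x (posY i))) => [/(lt_le_trans (ordering_Y_gt0 ord i))//|]; rewrite mulr0 eqxx.
have xZ j : (x (posZ j) < 0)%R.
  have := kern_neq0 (posZ j); rewrite kern_neg ?(ordering_Z_lt0 ord)//.
  by case: (leP (x (posZ j))) => [/le_lt_trans/(_ (ordering_Z_lt0 ord j))//|]; rewrite mulr0 eqxx.
have Yx k : (0 < x k)%R -> exists i, k = posY i.
  by case: (YZ_cover k) => [//|[j ->]]; rewrite ltNge (ltW (xZ j)).
have Zx k : (x k < 0)%R -> exists j, k = posZ j.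
  by case: (YZ_cover k) => [[i ->]|//]; rewrite ltNge (ltW (xY i)).
split.
- exact: (size_unique_values (b := fun y => 0 < y)%R xp xY Yx).
- exact: (size_unique_values (b := fun y => y < 0)%R xm xZ Zx).
- exact: (perm_unique_values (b := fun y => 0 < y)%R xp xY Yx).
- exact: (perm_unique_values (b := fun y => y < 0)%R xm xZ Zx).
Qed.

Lemma bayes_num_unique_values Sm Sp :
  bayes_num theta X t (paths_event posY posZ Sm Sp `&` unique_values_event posY posZ Sm Sp) =
  bayes_num theta X t (paths_event posY posZ Sm Sp).
Proof.
rewrite /bayes_num integral_mkcond [RHS]integral_mkcond; apply: eq_integral => w _.
rewrite !patchE; have [lik0|lik] := eqVneq (likelihood theta (fun k => X k w) t) 0%R.
  by rewrite lik0; do 2 case: ifP.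
suff -> : (w \in [set w | paths_event posY posZ Sm Sp (fun k => X k w)]) =
    (w \in [set w | (paths_event posY posZ Sm Sp `&` unique_values_event posY posZ Sm Sp)
       (fun k => X k w)]) by [].
apply/idP/idP; rewrite !inE; last by case.
by move=> wE; split=> //; exact: unique_values_on_paths.
Qed.

End PosteriorLaw.

Theorem theorem2p1 (R : realType) (d : measure_display)
    (Omega : measurableType d) (P : probability Omega R)
    (H : probability (measurableTypeR R) R) (K : pred nat)
    (W xi : nat -> {RV P >-> measurableTypeR R})
    (G : Omega -> probability (measurableTypeR R) R)
    (chi : seq nat -> R) (theta : R) (N : nat)
    (X T : 'I_N -> {RV P >-> measurableTypeR R})
    (hG : species_sampling H K W xi G)
    (hchi : is_eppf P H G chi)
    (hXT : latent_model theta G X T) :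
  (* the Bayes posterior is a version of the law of X given T *)
  (forall A B : 'I_N -> set (measurableTypeR R),
    (forall k, measurable (A k)) -> (forall k, measurable (B k)) ->
    fine (P [set w | forall k, A k (X k w) /\ B k (T k w)])
    = (\int[P]_(w in [set w | forall k, B k (T k w)])
         posterior theta X (fun k => T k w)
           [set x | forall k, A k (x k)])%R)
  /\
  forall t : 'I_N -> R, (0 < marginal_density theta X t)%E ->
  forall (n : nat) (posY : 'I_n -> 'I_N) (posZ : 'I_(N - n) -> 'I_N),
    ordering theta t posY posZ ->
    (* (i) *)
    (let weight Sm Sp :=
       phi_pos H chi theta t posY Sp * phi_neg H chi theta t posZ Sm Sp in
     let total := \sum_(Sm : spath (N - n)) \sum_(Sp : spath n) weight Sm Sp in
     0 < total /\
     forall (Sm : spath (N - n)) (Sp : spath n),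
       posterior theta X t (paths_event posY posZ Sm Sp)
       = weight Sm Sp / total)
    /\
    (* (ii) *)
    (forall (Sm : spath (N - n)) (Sp : spath n),
      let E := paths_event posY posZ Sm Sp in
      0 < posterior theta X t E ->
      posterior theta X t (E `&` unique_values_event posY posZ Sm Sp)
        / posterior theta X t E = 1
      /\
      forall (A : 'I_n -> set (measurableTypeR R))
             (B : 'I_(N - n) -> set (measurableTypeR R)),
        (forall j, measurable (A j)) -> (forall j, measurable (B j)) ->
        posterior theta X t (E `&` UV_event posY posZ Sm Sp A B)
          / posterior theta X t E
        = (\prod_(j < n | (0 < jump Sp j)%N)
             law_U H theta t posY j (jump Sp j) (A j)) *
          (\prod_(j < N - n | (0 < jump Sm j)%N)
             law_V H theta t posZ j (jump Sm j) (B j))).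
Proof.
have H0 := ssm_nonatomic hG.
have mG := species_measurable hG.
split; first by move=> A B mA mB; exact: (bayes_version mG hXT).
move=> t marg_gt0 n posY posZ ord.
have margE := marginal_density_paths H0 hchi hXT ord.
have bayesE := bayes_num_paths_event H0 hchi hXT ord.
split.
  move=> weight total; have total_gt0 : 0 < total by rewrite -lte_fin -margE.
  by split=> // Sm Sp; rewrite /posterior bayesE margE.
move=> Sm Sp E E_gt0; split.
  by rewrite /posterior (bayes_num_unique_values X ord) divff// gt_eqF.
move=> A B mA mB; rewrite /law_U /law_V !prodf_div.
move: E_gt0; rewrite /posterior (bayes_num_paths H0 hchi hXT ord _ _ mA mB).
rewrite bayesE (phi_product H0 hchi hXT ord) /path_mass /=.
(* every factor is nonzero because the posterior of the paths is positive *)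
set c := (_ * _)%:R; set m := fine _; set x := chi _.
set a := \prod_(j < n | _) int_pos _ _ _ setT.
set b := \prod_(j < N - n | _) int_neg _ _ _ setT.
move=> /lt0r_neq0; rewrite !mulf_eq0 invr_eq0 !negb_or.
case/andP => /andP[c0 /andP[x0 /andP[a0 b0]]] m0.
by clearbody c x m a b; field; rewrite c0 x0 a0 b0 m0.
Qed.
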